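(* There is a deterministic algorithm that, given any $k\times k$ matrix-weighted graph $G=(V,E)$ on $n$ vertices with edge weights $\phi_{uv}\phi_{uv}^T$ and any $\gamma\ge1$, terminates in finite time and outputs a scaling $s:E\to[0,1]$ such that: (1) the rescaled graph $G^s$ is $\gamma$-almost regular, i.e. $(\phi^s_{uv})^T(D_u^s)^\dagger\phi^s_{uv}\le\frac{\gamma k}{n}$ for all $(u,v)\in E$ (and each endpoint $u$); (2) the number of edges $(u,v)\in E$ with $s_{uv}\in(0,1)$ is at most $\frac{8n^2}{\gamma}$; (3) the number of edges $(u,v)\in E$ with $s_{uv}=0$ is at most $\frac{8n}{\gamma k}(\mathrm{rank}(D)-\mathrm{rank}(D^s))$.
   Context: A $k\times k$ matrix-weighted graph $G=(V,E)$, $|V|=n$, assigns to each edge $(u,v)$ a vector $\phi_{uv}\in\mathbb{R}^k$ (matrix weight $\phi_{uv}\phi_{uv}^T$). $D_u=\sum_{v:(u,v)\in E}\phi_{uv}\phi_{uv}^T$ and $D$ is the $nk\times nk$ block diagonal matrix with blocks $D_u$. For a scaling $s:E\to[0,1]$, $G^s$ has vectors $\phi^s_{uv}=s_{uv}\phi_{uv}$, with $D^s_u=\sum_{v}(s_{uv}\phi_{uv})(s_{uv}\phi_{uv})^T$ and $D^s$ block diagonal with blocks $D^s_u$. $\dagger$ is the Moore–Penrose pseudoinverse. *)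

(* Defs.v *)
From HB Require Import structures.
From mathcomp Require Import all_boot all_order all_algebra.
From mathcomp Require Import boolp classical_sets reals.

Set Implicit Arguments.
Unset Strict Implicit.
Unset Printing Implicit Defensive.

Import Order.TTheory GRing.Theory Num.Theory.
Local Open Scope ring_scope.

(** * Moore-Penrose pseudoinverse *)

(* MathComp's [pinvmx] is only a generalized inverse; the Moore-Penrose one is
   the unique solution of the four Penrose equations. *)
Definition is_mp_inverse (R : realType) m n (A : 'M[R]_(m, n))
    (X : 'M[R]_(n, m)) : Prop :=
  [/\ A *m X *m A = A, X *m A *m X = X,
      (A *m X)^T = A *m X & (X *m A)^T = X *m A].

Definition mp_inverse (R : realType) m n (A : 'M[R]_(m, n)) : 'M[R]_(n, m) :=
  xget 0 (fun X => is_mp_inverse A X).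

Lemma row_mul_tr_eq0 (R : realType) n (v : 'rV[R]_n) : v *m v^T = 0 -> v = 0.
Proof.
move=> /matrixP/(_ ord0 ord0); rewrite !mxE => h.
apply/rowP => j; rewrite mxE; apply/eqP; rewrite -sqrf_eq0.
have /psumr_eq0P : forall i, xpredT i -> 0 <= v 0 i ^+ 2.
  by move=> i _; exact: sqr_ge0.
move=> -> //; rewrite -[RHS]h; apply: eq_bigr => i _.
by rewrite mxE expr2.
Qed.

Lemma gram_unitmx (R : realType) m n (B : 'M[R]_(m, n)) :
  row_free B -> B *m B^T \in unitmx.
Proof.
move=> fB; rewrite -row_free_unit; apply: inj_row_free => v hv.
have : (v *m B) *m (v *m B)^T = 0.
  by rewrite trmx_mul !mulmxA -[v *m B *m _]mulmxA hv mul0mx.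
move/row_mul_tr_eq0 => vB0; apply: (row_free_inj fB).
by rewrite vB0 mul0mx.
Qed.

Lemma mp_inverse_factor (R : realType) m r n (C : 'M[R]_(m, r))
    (B : 'M[R]_(r, n)) :
  row_full C -> row_free B -> exists X, is_mp_inverse (C *m B) X.
Proof.
move=> fC fB; have uB := gram_unitmx fB.
have uC : C^T *m C \in unitmx.
  by rewrite -{2}[C]trmxK; apply: gram_unitmx; rewrite /row_free mxrank_tr.
pose M := invmx (B *m B^T); pose N := invmx (C^T *m C).
have MT : M^T = M by rewrite /M trmx_inv trmx_mul trmxK.
have NT : N^T = N by rewrite /N trmx_inv trmx_mul trmxK.
pose X := B^T *m M *m (N *m C^T).
have AX : C *m B *m X = C *m N *m C^T.
  rewrite /X -!mulmxA; congr (_ *m _); rewrite !mulmxA.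
  by rewrite (mulmxV uB) mul1mx.
have XA : X *m (C *m B) = B^T *m M *m B.
  rewrite /X -!mulmxA; congr (_ *m (_ *m _)).
  by rewrite [C^T *m _]mulmxA mulmxA (mulVmx uC) mul1mx.
exists X; split.
- by rewrite AX -!mulmxA [C^T *m _]mulmxA [N *m _]mulmxA (mulVmx uC) mul1mx.
- rewrite XA /X -!mulmxA [B *m _]mulmxA [M *m (B *m B^T *m _)]mulmxA.
  by rewrite (mulVmx uB) mul1mx.
- by rewrite AX !trmx_mul trmxK NT mulmxA.
- by rewrite XA !trmx_mul trmxK MT mulmxA.
Qed.

Lemma mp_inverse_exists (R : realType) m n (A : 'M[R]_(m, n)) :
  exists X, is_mp_inverse A X.
Proof.
have := mp_inverse_factor (col_base_full A) (row_base_free A).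
by rewrite mulmx_base.
Qed.

Lemma mp_inverseP (R : realType) m n (A : 'M[R]_(m, n)) :
  is_mp_inverse A (mp_inverse A).
Proof. exact: (xgetPex 0 (mp_inverse_exists A)). Qed.

Lemma mp_inverse_unique (R : realType) m n (A : 'M[R]_(m, n)) X Y :
  is_mp_inverse A X -> is_mp_inverse A Y -> X = Y.
Proof.
move=> [x1 x2 x3 x4] [y1 y2 y3 y4].
have AXY : A *m X = A *m Y.
  rewrite -x3 -{1}y1 -[A *m Y *m A *m X]mulmxA trmx_mul x3 y3.
  by rewrite mulmxA x1.
have XYA : X *m A = Y *m A.
  rewrite -x4 -{1}y1 -[A *m Y *m A]mulmxA [X *m _]mulmxA trmx_mul x4 y4.
  by rewrite -mulmxA [A *m (X *m A)]mulmxA x1.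
by rewrite -x2 XYA -mulmxA AXY mulmxA y2.
Qed.

(** * Matrix-weighted graphs *)

(* A finite simple graph on the vertices 0, ..., n-1.  An undirected edge
   carries one vector, so [phi] is symmetric; its values off the edges are
   irrelevant. *)
Record mwgraph (R : realType) (n k : nat) := MWGraph {
  adj : rel 'I_n;
  phi : 'I_n -> 'I_n -> 'cV[R]_k;
  adj_sym : symmetric adj;
  adj_irr : irreflexive adj;
  phi_sym : forall u v, phi u v = phi v u }.

(* Each undirected edge is listed once, as the pair (u, v) with u < v. *)
Definition edges (R : realType) n k (G : mwgraph R n k) : {set 'I_n * 'I_n} :=
  [set p : 'I_n * 'I_n | (p.1 < p.2)%N && adj G p.1 p.2]%SET.

Definition vdeg (R : realType) n k (G : mwgraph R n k) (u : 'I_n) : 'M[R]_k :=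
  \sum_(v < n | adj G u v) phi G u v *m (phi G u v)^T.

Definition degmx (R : realType) n k (G : mwgraph R n k) :
    'M[R]_(\sum_(u < n) k) :=
  \mxdiag_(u < n) vdeg G u.

Definition almost_regular (R : realType) n k (gamma : R) (G : mwgraph R n k) :
    Prop :=
  forall u v, adj G u v ->
    ((phi G u v)^T *m mp_inverse (vdeg G u) *m phi G u v) 0 0
      <= gamma * k%:R / n%:R.

(* Only the values on edges matter. *)
Record scaling (R : realType) n k (G : mwgraph R n k) := Scaling {
  scal : 'I_n -> 'I_n -> R;
  scal_sym : forall u v, scal u v = scal v u;
  scal_in01 : forall u v, adj G u v -> 0 <= scal u v <= 1 }.

Lemma rescale_phi_sym (R : realType) n k (G : mwgraph R n k) (s : scaling G) :
  forall u v, scal s u v *: phi G u v = scal s v u *: phi G v u.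
Proof. by move=> u v; rewrite scal_sym phi_sym. Qed.

(* Edges scaled by 0 stay in the edge set. *)
Definition rescale (R : realType) n k (G : mwgraph R n k) (s : scaling G) :
    mwgraph R n k :=
  MWGraph (adj_sym G) (adj_irr G) (rescale_phi_sym s).

(** * Algorithms over the reals

   Deterministic while-programs for the real random access machine: memory
   consists of arrays of natural numbers and arrays of reals (array [a], cell
   [i]), with computed indices.  Real cells are only accessible through field
   operations, embedding of naturals and exact comparison; programs contain no
   real constants. *)

Inductive nexp : Type :=
| NConst of nat
| NGet of nat & nexp
| NAdd of nexp & nexp
| NSub of nexp & nexp
| NMul of nexp & nexp
| NDiv of nexp & nexp
| NMod of nexp & nexp.

Inductive rexp : Type :=
| RNat of nexp
| RGet of nat & nexp
| RAdd of rexp & rexp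
| RSub of rexp & rexp
| RMul of rexp & rexp
| RDiv of rexp & rexp.

Inductive bexp : Type :=
| BLtN of nexp & nexp
| BLtR of rexp & rexp
| BNot of bexp
| BAnd of bexp & bexp.

Inductive cmd : Type :=
| Skip
| NSet of nat & nexp & nexp
| RSet of nat & nexp & rexp
| Seq of cmd & cmd
| If of bexp & cmd & cmd
| While of bexp & cmd.

Record state (R : realType) := State {
  nmem : nat -> nat -> nat;
  rmem : nat -> nat -> R }.

Definition upd (T : Type) (m : nat -> nat -> T) (a i : nat) (x : T) :
    nat -> nat -> T :=
  fun b j => if (b == a) && (j == i) then x else m b j.

Fixpoint neval (R : realType) (st : state R) (e : nexp) : nat :=
  match e with
  | NConst c => c
  | NGet a i => nmem st a (neval st i)
  | NAdd x y => (neval st x + neval st y)%N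
  | NSub x y => (neval st x - neval st y)%N
  | NMul x y => (neval st x * neval st y)%N
  | NDiv x y => (neval st x %/ neval st y)%N
  | NMod x y => (neval st x %% neval st y)%N
  end.

Fixpoint reval (R : realType) (st : state R) (e : rexp) : R :=
  match e with
  | RNat x => (neval st x)%:R
  | RGet a i => rmem st a (neval st i)
  | RAdd x y => reval st x + reval st y
  | RSub x y => reval st x - reval st y
  | RMul x y => reval st x * reval st y
  | RDiv x y => reval st x / reval st y
  end.

Fixpoint beval (R : realType) (st : state R) (b : bexp) : bool :=
  match b with
  | BLtN x y => (neval st x < neval st y)%N
  | BLtR x y => reval st x < reval st y
  | BNot c => ~~ beval st c
  | BAnd c d => beval st c && beval st d
  end.

(* [exec c st st']: started in [st], the program [c] terminates (after finitely
   many steps) in [st']. *)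
Inductive exec (R : realType) : cmd -> state R -> state R -> Prop :=
| ESkip st : exec Skip st st
| ENSet st a i e :
    exec (NSet a i e) st
      (State (upd (nmem st) a (neval st i) (neval st e)) (rmem st))
| ERSet st a i e :
    exec (RSet a i e) st
      (State (nmem st) (upd (rmem st) a (neval st i) (reval st e)))
| ESeq c d st1 st2 st3 :
    exec c st1 st2 -> exec d st2 st3 -> exec (Seq c d) st1 st3
| EIfT b c d st st' :
    beval st b = true -> exec c st st' -> exec (If b c d) st st'
| EIfF b c d st st' :
    beval st b = false -> exec d st st' -> exec (If b c d) st st'
| EWhileF b c st : beval st b = false -> exec (While b c) st st
| EWhileT b c st1 st2 st3 :
    beval st1 b = true -> exec c st1 st2 -> exec (While b c) st2 st3 ->
    exec (While b c) st1 st3.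

Lemma exec_deterministic (R : realType) c (st st1 st2 : state R) :
  exec c st st1 -> exec c st st2 -> st1 = st2.
Proof.
move=> h; elim: h st2 => {c st st1}.
- by move=> st st2 h; inversion h.
- by move=> st a i e st2 h; inversion h.
- by move=> st a i e st2 h; inversion h.
- move=> c d s1 s2 s3 _ IH1 _ IH2 st2 h; inversion h; subst.
  by apply: IH2; rewrite (IH1 _ H1).
- move=> b c d s s' hb _ IH st2 h; inversion h; subst; first exact: IH.
  by rewrite hb in H4.
- move=> b c d s s' hb _ IH st2 h; inversion h; subst; last exact: IH.
  by rewrite hb in H4.
- by move=> b c s hb st2 h; inversion h; subst => //; rewrite hb in H1.
- move=> b c s1 s2 s3 hb _ IH1 _ IH2 st2 h; inversion h; subst.
    by rewrite hb in H3.
  by apply: IH2; rewrite (IH1 _ H2).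
Qed.

(** * Input and output conventions *)

Definition ext_ord (T : Type) (d : T) n (f : 'I_n -> T) (i : nat) : T :=
  oapp f d (insub i).

(* Naturals: array 0 holds n and k in cells 0 and 1; array 1 holds the 0/1
   adjacency matrix, entry (u, v) in cell u * n + v.
   Reals: array 0 holds gamma in cell 0; array 1 holds the edge vectors, the
   i-th coordinate of phi_uv in cell (u * n + v) * k + i (0 for non-edges).
   All other cells are 0. *)
Definition init_state (R : realType) n k (gamma : R) (G : mwgraph R n k) :
    state R :=
  State
    (fun a j => match a with
       | 0%N => nth 0%N [:: n; k] j
       | 1%N => ext_ord 0%N (fun u => ext_ord 0%N (fun v => nat_of_bool (adj G u v))
                  (j %% n)%N) (j %/ n)%N
       | _ => 0%N
       end)
    (fun a j => match a with
       | 0%N => nth 0 [:: gamma] j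
       | 1%N => ext_ord 0 (fun u => ext_ord 0 (fun v => ext_ord 0 (fun i =>
                  if adj G u v then phi G u v i 0 else 0)
                  (j %% k)%N) (j %/ k %% n)%N) (j %/ k %/ n)%N
       | _ => 0
       end).

(* The scaling is read off real array 2, s_uv from cell u * n + v. *)
Definition outputs (R : realType) n k (G : mwgraph R n k) (st : state R)
    (s : scaling G) : Prop :=
  forall u v : 'I_n, adj G u v -> rmem st 2 (u * n + v)%N = scal s u v.

Lemma init_adjE (R : realType) n k (gamma : R) (G : mwgraph R n k) (u v : 'I_n) :
  nmem (init_state gamma G) 1 (u * n + v)%N = adj G u v.
Proof.
have n0 : (0 < n)%N by apply: leq_ltn_trans (ltn_ord u).
by rewrite /= /ext_ord divnMDl // modnMDl divn_small // modn_small // addn0 !valK.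
Qed.

Lemma init_phiE (R : realType) n k (gamma : R) (G : mwgraph R n k) (u v : 'I_n)
    (i : 'I_k) : adj G u v ->
  rmem (init_state gamma G) 1 ((u * n + v) * k + i)%N = phi G u v i 0.
Proof.
move=> uv; have n0 : (0 < n)%N by apply: leq_ltn_trans (ltn_ord u).
have k0 : (0 < k)%N by apply: leq_ltn_trans (ltn_ord i).
rewrite /= /ext_ord [((_ + i) %/ k)%N]divnMDl // [((_ + i) %% k)%N]modnMDl.
rewrite (divn_small (ltn_ord i)) (modn_small (ltn_ord i)) addn0.
rewrite divnMDl // modnMDl divn_small // modn_small // addn0.
by rewrite !valK /= uv.
Qed.

(* Main.v *)
Require Import Defs.
From HB Require Import structures.
From mathcomp Require Import all_boot all_order all_algebra.
From mathcomp Require Import reals.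
From mathcomp Require Import zify ring lra.
Import Order.TTheory GRing.Theory Num.Theory.
Local Open Scope ring_scope.

Set Implicit Arguments.
Unset Strict Implicit.
Unset Printing Implicit Defensive.

(** The program searches exhaustively for scalings of the form [s_uv = 1 / d_uv]
with natural [d_uv] (where [1 / 0 = 0]) and stops at the first one that passes
an exact test of the three conditions.  The leverage score [x_v^T D_u^+ x_v] of
[x_v = s_uv phi_uv] is found by eliminating the first [k] pivots of the Gram
matrix of the [k + 1] rows of [(x_w, [w = v])_w]: the last pivot is one minus
the score.  Ranks are sums of leverage scores.

For the search to succeed, a good scaling must exist.  Put [tau = gamma k / n].
A score is at most [t] iff [(z . x)^2 <= t z^T D z] for all [z], so lowering the
weight of one edge never helps another edge.  Among weights [4^-m_e],
[m_e <= T], subject to the score of [e] being at most [t] unless [m_e = T],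
take one with minimal [\sum_e m_e]; then every edge with [m_e > 0] has score
more than [t / 4] at an endpoint.  If [T] is large, the values [m_e] leave a wide gap
by the pigeonhole principle, and the edges beyond it are deleted.  Deletion
multiplies the other scores by at most [1 + eta]; since the scores at a vertex
sum to the rank, this bounds both the number of fractional edges and, up to a
small error absorbed by integrality of the rank, the number of deleted edges. *)

(** * Leverage scores *)

(** By Lagrange's identity, the right side minus the left is half the sum over [i] and [j] of
    [w i * w j * (a i * b j - a j * b i) ^+ 2]. *)
Lemma weighted_cauchy_schwarz (R : realType) (I : finType) (w a b : I -> R) :
  (forall i, 0 <= w i) ->
  (\sum_i w i * a i * b i) ^+ 2
    <= (\sum_i w i * a i ^+ 2) * (\sum_i w i * b i ^+ 2).
Proof.
move=> w0.
have sq : 0 <= \sum_i \sum_j w i * w j * (a i * b j - a j * b i) ^+ 2.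
  apply: sumr_ge0 => i _; apply: sumr_ge0 => j _.
  exact: mulr_ge0 (mulr_ge0 (w0 i) (w0 j)) (sqr_ge0 _).
have e1 : (\sum_i w i * a i ^+ 2) * (\sum_i w i * b i ^+ 2) =
    \sum_i \sum_j w i * w j * (a i * b j) ^+ 2.
  rewrite big_distrlr /=; apply: eq_bigr => i _; apply: eq_bigr => j _; ring.
have e2 : (\sum_i w i * a i ^+ 2) * (\sum_i w i * b i ^+ 2) =
    \sum_i \sum_j w i * w j * (a j * b i) ^+ 2.
  rewrite mulrC big_distrlr /=; apply: eq_bigr => i _; apply: eq_bigr => j _; ring.
have e3 : (\sum_i w i * a i * b i) ^+ 2 =
    \sum_i \sum_j w i * w j * (a i * b j * (a j * b i)).
  rewrite expr2 big_distrlr /=; apply: eq_bigr => i _; apply: eq_bigr => j _; ring.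
have e4 : \sum_i \sum_j w i * w j * (a i * b j - a j * b i) ^+ 2 =
    \sum_i \sum_j w i * w j * (a i * b j) ^+ 2
    + \sum_i \sum_j w i * w j * (a j * b i) ^+ 2
    - (\sum_i \sum_j w i * w j * (a i * b j * (a j * b i))) *+ 2.
  rewrite -sumrMnl -big_split -sumrB /=; apply: eq_bigr => i _.
  rewrite -sumrMnl -big_split -sumrB /=; apply: eq_bigr => j _; ring.
by move: sq; rewrite e4 -e1 -e2 -e3; lra.
Qed.

(** Cancelling the full-rank factors of [P] in [P *m P = P] leaves [row_base P *m col_base P = 1],
    an identity matrix of size [\rank P]; the trace is cyclic. *)
Lemma mxtrace_idem (R : realType) n (P : 'M[R]_n) :
  P *m P = P -> \tr P = (\rank P)%:R.
Proof.
move=> PP; have bc : row_base P *m col_base P = 1%:M.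
  have : col_base P *m (row_base P *m col_base P) *m row_base P
         = col_base P *m 1%:M *m row_base P.
    rewrite mulmx1 mulmxA mulmx_base -mulmxA; exact: (etrans (congr1 _ (mulmx_base P)) PP).
  by move/(row_free_inj (row_base_free P))/(row_full_inj (col_base_full P)).
by rewrite -{1}(mulmx_base P) mxtrace_mulC bc mxtrace1.
Qed.

Definition dotc (R : realType) k (z y : 'cV[R]_k) : R := (z^T *m y) 0 0.

Definition lev (R : realType) k (D : 'M[R]_k) (x : 'cV[R]_k) : R :=
  (x^T *m mp_inverse D *m x) 0 0.

(** The weight [w e] stands for the square of a scaling factor. *)
Definition wdeg (R : realType) (E : finType) k (w : E -> R)
    (x : E -> 'cV[R]_k) : 'M[R]_k :=
  \sum_e w e *: (x e *m (x e)^T).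

Section Dot.
Variables (R : realType) (k : nat).
Implicit Types (y z : 'cV[R]_k) (A D : 'M[R]_k).

Lemma dotcE z y : dotc z y = \sum_i z i 0 * y i 0.
Proof. by rewrite /dotc mxE; apply: eq_bigr => i _; rewrite mxE. Qed.

Lemma dotcC z y : dotc z y = dotc y z.
Proof. by rewrite !dotcE; apply: eq_bigr => i _; rewrite mulrC. Qed.

Lemma dotc_mulmx A z y : dotc z (A *m y) = dotc (A^T *m z) y.
Proof. by rewrite /dotc trmx_mul trmxK mulmxA. Qed.

Lemma dotc_sum (I : finType) z (F : I -> 'cV[R]_k) :
  dotc z (\sum_i F i) = \sum_i dotc z (F i).
Proof. by rewrite /dotc mulmx_sumr summxE. Qed.

Lemma dotcZ z a y : dotc z (a *: y) = a * dotc z y.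
Proof. by rewrite /dotc -scalemxAr mxE. Qed.

Lemma dotc_eq0 y : (forall z, dotc z y = 0) -> y = 0.
Proof.
move=> /(_ y); rewrite /dotc => h; apply: trmx_inj; rewrite trmx0.
apply: row_mul_tr_eq0; rewrite trmxK.
by apply/matrixP => i j; rewrite !ord1 h mxE.
Qed.

Lemma levE D y : lev D y = dotc y (mp_inverse D *m y).
Proof. by rewrite /lev /dotc mulmxA. Qed.

Lemma levZ D a y : lev D (a *: y) = a ^+ 2 * lev D y.
Proof.
rewrite !levE -scalemxAr dotcZ dotcC dotcZ dotcC; ring.
Qed.

(** For symmetric [D] the Penrose equations are stable under transposition, so uniqueness
    applies. *)
Lemma mp_inverse_sym D : D^T = D -> (mp_inverse D)^T = mp_inverse D.
Proof.
move=> DT; have [x1 x2 x3 x4] := mp_inverseP D.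
apply: (@mp_inverse_unique _ _ _ D) => //.
split.
- by apply: trmx_inj; rewrite !trmx_mul trmxK DT mulmxA x1.
- by apply: trmx_inj; rewrite !trmx_mul trmxK DT mulmxA x2.
- by rewrite trmx_mul trmxK DT -[LHS]x4 trmx_mul DT.
- by rewrite trmx_mul trmxK DT -[LHS]x3 trmx_mul DT.
Qed.

End Dot.

Section WeightedDegree.
Variables (R : realType) (E : finType) (k : nat) (x : E -> 'cV[R]_k).
Implicit Types (w : E -> R) (y z : 'cV[R]_k).

Lemma wdeg_sym w : (wdeg w x)^T = wdeg w x.
Proof.
rewrite /wdeg linear_sum; apply: eq_bigr => e _.
by rewrite linearZ /= trmx_mul trmxK.
Qed.

Lemma wdeg_mul w z : wdeg w x *m z = \sum_e (w e * dotc (x e) z) *: x e.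
Proof.
rewrite /wdeg mulmx_suml; apply: eq_bigr => e _.
rewrite -scalemxAl -mulmxA [(x e)^T *m z]mx11_scalar mul_mx_scalar scalerA.
by rewrite -/(dotc _ _).
Qed.

Lemma dotc_wdeg w y z :
  dotc y (wdeg w x *m z) = \sum_e w e * dotc y (x e) * dotc z (x e).
Proof.
rewrite wdeg_mul dotc_sum; apply: eq_bigr => e _.
rewrite dotcZ (dotcC (x e) z); ring.
Qed.

Lemma dotc_wdegC w y z : dotc y (wdeg w x *m z) = dotc z (wdeg w x *m y).
Proof. by rewrite !dotc_wdeg; apply: eq_bigr => e _; ring. Qed.

Lemma wdeg_cauchy_schwarz w y z : (forall e, 0 <= w e) ->
  dotc y (wdeg w x *m z) ^+ 2
    <= dotc y (wdeg w x *m y) * dotc z (wdeg w x *m z).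
Proof.
move=> w0; rewrite !dotc_wdeg.
have eqsq y' : \sum_e w e * dotc y' (x e) * dotc y' (x e)
    = \sum_e w e * dotc y' (x e) ^+ 2.
  by apply: eq_bigr => e _; rewrite expr2 mulrA.
by rewrite !eqsq; apply: weighted_cauchy_schwarz.
Qed.

(* [1 - D D^+] is symmetric and annihilated by [D], hence the quadratic form of
   [D] vanishes on its image, which forces orthogonality to every [x e]. *)
Lemma wdeg_range w e : (forall f, 0 <= w f) -> 0 < w e ->
  wdeg w x *m (mp_inverse (wdeg w x) *m x e) = x e.
Proof.
move=> w0 we; set D := wdeg w x; set X := mp_inverse D.
have DT : D^T = D := wdeg_sym w.
have [x1 x2 x3 x4] := mp_inverseP D; rewrite -/X in x1 x2 x3 x4.
pose Q := 1%:M - D *m X.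
have QT : Q^T = Q by rewrite /Q linearB /= trmx1 x3.
have DQ : D *m Q = 0.
  by apply: trmx_inj; rewrite trmx_mul DT QT trmx0 /Q mulmxBl mul1mx x1 subrr.
have : Q *m x e = 0.
  apply: dotc_eq0 => z; rewrite dotc_mulmx QT; set y := Q *m z.
  have : dotc y (D *m y) = 0.
    by rewrite /y mulmxA DQ mul0mx /dotc mulmx0 mxE.
  rewrite dotc_wdeg => /psumr_eq0P h.
  have /eqP : w e * dotc y (x e) * dotc y (x e) = 0.
    apply: h => // f _; rewrite -mulrA mulr_ge0 //; exact: sqr_ge0.
  by rewrite !mulf_eq0 (gt_eqF we) orbb /= => /eqP.
by rewrite /Q mulmxBl mul1mx => /subr0_eq; rewrite mulmxA.
Qed.

Lemma lev_quad w y :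
  lev (wdeg w x) (wdeg w x *m y) = dotc y (wdeg w x *m y).
Proof.
have [x1 _ _ _] := mp_inverseP (wdeg w x).
by rewrite levE dotcC dotc_mulmx wdeg_sym !mulmxA x1 dotcC.
Qed.

(** Put [y = D^+ x_e], so that [D y = x_e] and the score is [y^T D y]. One direction is
    Cauchy-Schwarz for the form [D]; the other takes [z = y] and cancels the score. *)
Lemma levP w e t : (forall f, 0 <= w f) -> 0 < w e -> 0 <= t ->
  lev (wdeg w x) (x e) <= t <->
  (forall z, dotc z (x e) ^+ 2 <= t * \sum_f w f * dotc z (x f) ^+ 2).
Proof.
move=> w0 we t0; set D := wdeg w x; set y := mp_inverse D *m x e.
have Dy : D *m y = x e := wdeg_range w0 we.
have lq : lev D (x e) = dotc y (D *m y) by rewrite -{1}Dy; apply: lev_quad.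
have qE z : dotc z (D *m z) = \sum_f w f * dotc z (x f) ^+ 2.
  by rewrite dotc_wdeg; apply: eq_bigr => f _; rewrite -mulrA -expr2.
have q0 z : 0 <= dotc z (D *m z).
  by rewrite qE sumr_ge0 // => f _; rewrite mulr_ge0 ?sqr_ge0.
split => [h z|h].
  rewrite -{1}Dy -qE; apply: le_trans (wdeg_cauchy_schwarz _ _ w0) _.
  by rewrite mulrC ler_wpM2r // -lq.
have := h y; rewrite -qE -Dy -lq expr2 Dy; case: (leP (lev D (x e)) t) => // tl.
by rewrite ler_pM2r ?(le_lt_trans t0 tl) // leNgt tl.
Qed.

(** In this form the pseudoinverse is gone and the right-hand side is monotone in the weights, which
    makes changes of weights easy to follow. *)
Lemma wlevP w e t : (forall f, 0 <= w f) -> 0 < w e -> 0 <= t ->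
  w e * lev (wdeg w x) (x e) <= t <->
  (forall z, w e * dotc z (x e) ^+ 2 <= t * \sum_f w f * dotc z (x f) ^+ 2).
Proof.
move=> w0 we t0; rewrite -ler_pdivlMl // levP ?mulr_ge0 ?invr_ge0 ?(ltW we) //.
by split=> h z; move: (h z); rewrite -mulrA ler_pdivlMl.
Qed.

Lemma lev_wdeg_ge0 w e : (forall f, 0 <= w f) ->
  0 <= w e * lev (wdeg w x) (x e).
Proof.
move=> w0; have := w0 e; rewrite le_eqVlt => /predU1P[<-|we].
  by rewrite mul0r.
apply: mulr_ge0; first exact: ltW.
rewrite -(wdeg_range w0 we) lev_quad // dotc_wdeg.
by apply: sumr_ge0 => f _; rewrite -mulrA mulr_ge0 // -expr2 sqr_ge0.
Qed.

(** Both sides are the trace of [D^+ D]: by cyclicity it is the sum of the scores, and by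
    idempotence it is the rank. *)
Lemma sum_lev w : \sum_e w e * lev (wdeg w x) (x e) = (\rank (wdeg w x))%:R.
Proof.
set D := wdeg w x; have [x1 x2 _ _] := mp_inverseP D.
have -> : \rank D = \rank (mp_inverse D *m D).
  apply/eqP; rewrite eqn_leq mxrankM_maxr andbT -{1}x1 -mulmxA.
  exact: mxrankM_maxr.
rewrite -mxtrace_idem; last by rewrite mulmxA x2.
rewrite {2}/D /wdeg mulmx_sumr raddf_sum; apply: eq_bigr => e _ /=.
rewrite -scalemxAr mxtraceZ mulmxA mxtrace_mulC mulmxA /lev /mxtrace.
by rewrite big_ord1.
Qed.

(** By [wdeg_range], [D' D'^+] fixes each [x e] with [w e != 0], hence fixes [wdeg w x]. *)
Lemma rank_wdeg_le w w' : (forall e, 0 <= w' e) ->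
    (forall e, w e != 0 -> 0 < w' e) ->
  (\rank (wdeg w x) <= \rank (wdeg w' x))%N.
Proof.
move=> w'0 ww'; set D' := wdeg w' x.
suff -> : wdeg w x = D' *m (mp_inverse D' *m wdeg w x) by exact: mxrankM_maxl.
rewrite /wdeg !mulmx_sumr; apply: eq_bigr => e _; rewrite -!scalemxAr.
have [->|/ww' we] := eqVneq (w e) 0; first by rewrite !scale0r.
by rewrite [mp_inverse _ *m _]mulmxA mulmxA wdeg_range.
Qed.

End WeightedDegree.

(** * Existence of a good scaling *)

Lemma ler_term_sum (R : realType) (I : finType) (F : I -> R) i :
  (forall j, 0 <= F j) -> F i <= \sum_j F j.
Proof. by move=> F0; rewrite (bigD1 i) //= lerDl sumr_ge0. Qed.

Section Existence.
Variables (R : realType) (V E : finType) (k : nat) (x : V -> E -> 'cV[R]_k).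

Let X (A : {set E}) u := mp_inverse (wdeg (fun e => (e \in A)%:R) (x u)).

(** Summing over all edge sets replaces a maximum: the constant depends on the vectors alone, so it
    is available before the weights, and with them [A], are chosen. *)
Definition gap_const : R :=
  \sum_A \sum_u \sum_e \sum_f dotc (X A u *m x u e) (x u f) ^+ 2.

Lemma gap_const_ge A u e :
  \sum_f dotc (X A u *m x u e) (x u f) ^+ 2 <= gap_const.
Proof.
have sq0 A' u' e' : 0 <= \sum_f dotc (X A' u' *m x u' e') (x u' f) ^+ 2.
  by apply: sumr_ge0 => f _; exact: sqr_ge0.
pose F A' u' e' := \sum_f dotc (X A' u' *m x u' e') (x u' f) ^+ 2.
apply: (le_trans (ler_term_sum (F := F A u) e (sq0 A u))).
apply: (le_trans (ler_term_sum (F := fun u' => \sum_e' F A u' e') u _)) => [u'|].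
  by apply: sumr_ge0 => e' _; exact: sq0.
apply: (ler_term_sum (F := fun A' => \sum_u' \sum_e' F A' u' e')) => A'.
by apply: sumr_ge0 => u' _; apply: sumr_ge0 => e' _; exact: sq0.
Qed.

Lemma gap_const_ge0 : 0 <= gap_const.
Proof. by do 4!(apply: sumr_ge0 => ? _); exact: sqr_ge0. Qed.

(* [z'] is the projection of [z] onto the span of the [x u e] with [e \in A]. *)
Lemma gap_projection (A : {set E}) u z :
  exists2 z', forall e, e \in A -> dotc z' (x u e) = dotc z (x u e) &
    forall e, dotc z' (x u e) ^+ 2
      <= gap_const * \sum_(f in A) dotc z (x u f) ^+ 2.
Proof.
pose w (e : E) : R := (e \in A)%:R.
have w0 e : 0 <= w e by rewrite ler0n.
have z'E e : dotc (X A u *m (wdeg w (x u) *m z)) (x u e)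
    = dotc (X A u *m x u e) (wdeg w (x u) *m z).
  by rewrite dotcC dotc_mulmx mp_inverse_sym ?wdeg_sym.
exists (X A u *m (wdeg w (x u) *m z)) => [e eA|e].
  by rewrite z'E dotc_wdegC wdeg_range // /w eA ltr01.
rewrite z'E dotc_wdeg; apply: le_trans (weighted_cauchy_schwarz _ _ w0) _.
have -> : \sum_i w i * dotc z (x u i) ^+ 2
    = \sum_(f in A) dotc z (x u f) ^+ 2.
  rewrite [RHS]big_mkcond; apply: eq_bigr => f _.
  by rewrite /w; case: (f \in A); rewrite ?mul1r ?mul0r.
apply: ler_wpM2r; first by apply: sumr_ge0 => f _; exact: sqr_ge0.
apply: le_trans (gap_const_ge A u e); apply: ler_sum => f _.
by rewrite /w; case: (f \in A); rewrite ?mul1r ?mul0r ?sqr_ge0.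
Qed.

(** * Deleting the edges of very small weight *)

Definition restrict_weight (A : {set E}) (w : E -> R) e :=
  if e \in A then w e else 0.

(** By [wlevP] it suffices to compare quadratic forms. Replacing [z] by its projection [z'] changes
    nothing on [A], while the deleted edges contribute at most [#|E| * b * gap_const * S], where [S]
    is the sum of [(z . x_f)^2] over [A]. The kept form is at least [a * S], so the hypothesis on
    [a] and [b] makes this a fraction [eta] of it. *)
Lemma lev_restrict (A : {set E}) u e (w : E -> R) (a b eta : R) :
    (forall f, 0 < w f) -> (forall f, f \in A -> a <= w f) ->
    (forall f, f \notin A -> w f <= b) ->
    0 < a -> 0 <= b -> 0 <= eta -> #|E|%:R * (b * gap_const) <= eta * a ->
  restrict_weight A w e * lev (wdeg (restrict_weight A w) (x u)) (x u e)
    <= (1 + eta) * (w e * lev (wdeg w (x u)) (x u e)).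
Proof.
move=> wp wa wb ap b0 eta0 small; have w0 f := ltW (wp f).
have lev0 := lev_wdeg_ge0 (x u) e w0.
case eA: (e \in A); last first.
  rewrite {1}/restrict_weight eA mul0r; apply: mulr_ge0 => //; lra.
set wA := restrict_weight A w.
have wA0 f : 0 <= wA f by rewrite /wA /restrict_weight; case: ifP.
have wAe : 0 < wA e by rewrite /wA /restrict_weight eA.
have t0 := mulr_ge0 (addr_ge0 ler01 eta0) lev0.
rewrite wlevP // => z.
have := (wlevP (x u) w0 (wp e) lev0).1 (lexx _).
set t := w e * lev _ _ => h; rewrite -/t in lev0.
have [z' zA zC] := gap_projection A u z.
have {1}-> : wA e = w e by rewrite /wA /restrict_weight eA.
rewrite -zA //; apply: le_trans (h z') _; set Q := \sum_f wA f * _.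
rewrite [leRHS]mulrAC [leRHS]mulrC. apply: ler_wpM2l => //.
set S := \sum_(f in A) dotc z (x u f) ^+ 2 in zC.
have S0 : 0 <= S by apply: sumr_ge0 => f _; exact: sqr_ge0.
have aSQ : a * S <= Q.
  rewrite /S /Q mulr_sumr big_mkcond; apply: ler_sum => f _.
  rewrite /wA /restrict_weight; case: ifP => fA; last by rewrite mul0r.
  by rewrite ler_wpM2r ?sqr_ge0 ?wa.
have C0 := gap_const_ge0.
have le1 : \sum_f w f * dotc z' (x u f) ^+ 2 <=
    Q + #|E|%:R * (b * gap_const) * S.
  have -> : #|E|%:R * (b * gap_const) * S = \sum_(f : E) b * (gap_const * S).
    by rewrite sumr_const cardT -cardE -mulr_natl; ring.
  rewrite -big_split; apply: ler_sum => f _ /=.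
  rewrite /wA /restrict_weight; case: ifPn => fA /=.
    by rewrite zA // lerDl !mulr_ge0.
  by rewrite mul0r add0r; apply: ler_pM; rewrite ?sqr_ge0 ?wb ?zC ?w0.
apply: le_trans le1 _; rewrite mulrDl mul1r lerD2l.
apply: le_trans (ler_wpM2r S0 small) _.
by rewrite -mulrA ler_wpM2l.
Qed.

(** Powers of 4 have square roots [2^-m], which are reciprocals of naturals and hence scalings that
    the search can reach. *)
Definition pow4 (m : E -> nat) (e : E) : R := (4^-1) ^+ m e.

Lemma pow4_gt0 m e : 0 < pow4 m e.
Proof. by rewrite exprn_gt0 // invr_gt0. Qed.

(* Lowering one exponent only helps the constraints of the other edges, so at a
   minimiser it must break the constraint of the edge itself. *)
Lemma truncated_minimizer (T : nat) (t : R) : 0 <= t ->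
  exists m : E -> nat,
    [/\ forall e, (m e <= T)%N,
        forall u e, (m e < T)%N ->
          pow4 m e * lev (wdeg (pow4 m) (x u)) (x u e) <= t
      & forall e, (0 < m e)%N ->
          exists u, t / 4 < pow4 m e * lev (wdeg (pow4 m) (x u)) (x u e)].
Proof.
move=> t0; have p0 m e : 0 <= pow4 m e := ltW (pow4_gt0 m e).
pose nm (m : {ffun E -> 'I_T.+1}) e : nat := m e.
pose feas (m : {ffun E -> 'I_T.+1}) := [forall u, forall e, (m e < T)%N ==>
  (pow4 (nm m) e * lev (wdeg (pow4 (nm m)) (x u)) (x u e) <= t)].
(* An edge at the cap [T] is exempt from its constraint, so the constant [T] is feasible. *)
have feas0 : feas [ffun=> ord_max].
  by apply/forallP => u; apply/forallP => e; rewrite ffunE ltnn.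
case: (arg_minnP (fun m : {ffun E -> 'I_T.+1} => \sum_e (m e : nat))%N feas0).
move=> m fm mmin; exists (nm m).
have mfeas u e : (m e < T)%N ->
    pow4 (nm m) e * lev (wdeg (pow4 (nm m)) (x u)) (x u e) <= t.
  by move=> eT; move/forallP: fm => /(_ u)/forallP/(_ e)/implyP/(_ eT).
split => // [e|e me]; first exact: leq_ord.
have [/existsP[u hu]|] := boolP [exists u,
  t / 4 < pow4 (nm m) e * lev (wdeg (pow4 (nm m)) (x u)) (x u e)]; first by exists u.
rewrite negb_exists => /forallP noU; exfalso.
pose m' : {ffun E -> 'I_T.+1} :=
  [ffun f => if f == e then inord (m e).-1 else m f].
have m'e : m' e = (m e).-1 :> nat.
  by rewrite ffunE eqxx inordK // (leq_ltn_trans (leq_pred _)).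
have m'f f : f != e -> m' f = m f by rewrite ffunE => /negPf ->.
have we : pow4 (nm m') e = 4 * pow4 (nm m) e.
  have pk : (m e).-1.+1 = m e := prednK me.
  rewrite /pow4 /nm m'e -[in RHS]pk exprS mulrA divff ?mul1r //.
  by rewrite pnatr_eq0.
have wf f : f != e -> pow4 (nm m') f = pow4 (nm m) f by rewrite /pow4 /nm => /m'f ->.
have wle f : pow4 (nm m) f <= pow4 (nm m') f.
  have [->|/wf -> //] := eqVneq f e; rewrite we; have := p0 (nm m) e; lra.
have qle u z : \sum_f pow4 (nm m) f * dotc z (x u f) ^+ 2
    <= \sum_f pow4 (nm m') f * dotc z (x u f) ^+ 2.
  by apply: ler_sum => f _; rewrite ler_wpM2r ?sqr_ge0.
have fm' : feas m'.
  apply/forallP => u; apply/forallP => f; apply/implyP => fT.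
  rewrite wlevP ?pow4_gt0 // => z; have [fe|fe] := eqVneq f e.
    (* The score of [e] was at most [t / 4] and its weight grows by a factor 4, so its new score is
       at most [t]. *)
    rewrite fe we; have := noU u; rewrite -leNgt.
    rewrite wlevP ?pow4_gt0 ?divr_ge0 // => /(_ z).
    by have := qle u z; nra.
  rewrite wf //; apply: (@le_trans _ _ (t * \sum_f pow4 (nm m) f * dotc z (x u f) ^+ 2)).
    apply: (wlevP (x u) _ _ _).1 => //; first exact: pow4_gt0.
    by apply: mfeas; rewrite -(m'f _ fe).
  by rewrite ler_wpM2l.
have s1 : (\sum_f m' f = (m e).-1 + \sum_(f | f != e) m f)%N.
  by rewrite (bigD1 e) //= m'e; congr addn; apply: eq_bigr => f /m'f ->.
have s2 : (\sum_f m f = m e + \sum_(f | f != e) m f)%N by rewrite (bigD1 e).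
by have := mmin _ fm'; rewrite s1 s2 leq_add2r -ltnS (prednK me) ltnn.
Qed.

(** Pigeonhole: the numbers [(m e - 1) / g] miss one of the [#|E| + 1] levels [j], and then no
    exponent lies above [j * g] and at most at [(j + 1) * g]. *)
Lemma level_gap (m : E -> nat) (g : nat) :
  exists2 j, (j <= #|E|)%N &
    forall e, (j * g < m e -> j.+1 * g < m e)%N.
Proof.
have [g0|g0] := posnP g.
  by exists 0%N => // e; rewrite g0 !muln0.
(* Levels beyond [#|E|] are sent to 0 by [inord]. This is harmless: only a level equal to [j], which
   is in range, is decoded below. *)
pose lvl e : 'I_#|E|.+1 := inord ((m e).-1 %/ g).
have [j jn] : exists j, j \notin codom lvl.
  apply/existsP; rewrite -negb_forall; apply/negP => /forallP h.
  have : (#|'I_#|E|.+1| <= #|codom lvl|)%N.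
    by apply: subset_leq_card; apply/subsetP => j _; exact: h.
  rewrite card_ord => /leq_trans/(_ (leq_image_card lvl _)).
  by rewrite ltnn.
exists j => [|e jm]; first exact: leq_ord.
have m0 : (0 < m e)%N := leq_ltn_trans (leq0n _) jm.
have jle : (j <= (m e).-1 %/ g)%N by rewrite leq_divRL // -ltnS prednK.
suff : (j < (m e).-1 %/ g)%N by rewrite leq_divRL // -ltnS prednK.
rewrite ltn_neqAle jle andbT; apply/eqP => je.
by move/negP: jn; apply; apply/codomP; exists e; apply: val_inj;
  rewrite /= inordK -je.
Qed.

Lemma small_pow4 (y eta : R) : 0 < eta ->
  exists2 g, (0 < g)%N & y * (4^-1) ^+ g <= eta.
Proof.
move=> eta0; pose g := (Num.bound (y / eta)).+1; exists g => //.
have yg : y / eta < 2 ^+ g by apply: upper_nthrootP; exact: leqnSn.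
have le24 : (2 : R) ^+ g <= 4 ^+ g.
  by apply: lerXn2r; rewrite ?nnegrE ?ler0n // ler_nat.
have p4 : 0 < (4 : R) ^+ g by rewrite exprn_gt0.
rewrite exprVn ler_pdivrMr //; move: yg; rewrite ltr_pdivrMr // => /ltW/le_trans.
by apply; rewrite mulrC ler_pM2l.
Qed.

Lemma good_denominators (tau : R) : 0 < tau ->
  exists d : E -> nat, let w e : R := (d e)%:R^-1 ^+ 2 in
    [/\ forall u e, w e * lev (wdeg w (x u)) (x u e) <= tau,
        #|[set e | (1 < d e)%N]|%:R * tau <= 8 * (#|V| * k)%:R
      & #|[set e | d e == 0%N]|%:R * tau
          <= 8 * (\sum_u (\rank (wdeg (fun=> 1) (x u)))%:R
                  - \sum_u (\rank (wdeg w (x u)))%:R)].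
Proof.
move=> tau0; pose N : R := (#|V| * k)%:R.
have N0 : 0 <= N by rewrite ler0n.
pose c := Num.min 1 tau.
have c0 : 0 < c by rewrite lt_min ltr01.
have c1 : c <= 1 by rewrite ge_min lexx.
have ct : c <= tau by rewrite ge_min lexx orbT.
(* The total error [eta * N] must stay below both [1 / 16] and [tau / 16], for the two cases at the
   end. *)
pose eta := c / (16 * (N + 1)).
have eta0 : 0 < eta by rewrite divr_gt0 // mulr_gt0 //; lra.
have etaE : eta * N + eta = c / 16.
  by rewrite /eta; field; rewrite gt_eqF //; lra.
have etaN : 0 <= eta * N by rewrite mulr_ge0 // ltW.
(* The room needed for the growth of the scores under deletion. *)
pose t := tau / (1 + eta).
have tE : (1 + eta) * t = tau by rewrite /t mulrC divfK // gt_eqF //; lra.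
have t0 : 0 < t by rewrite divr_gt0 //; lra.
have [g g0 gs] := small_pow4 (#|E|%:R * gap_const) eta0.
(* The cap exceeds [j * g] for every level [j <= #|E|], so no kept edge is exempt from its
   constraint. *)
have [m [mT mlev mbig]] := truncated_minimizer (#|E|.+1 * g) (ltW t0).
have [j jE jgap] := level_gap m g.
pose w := pow4 m; have wp e : 0 < w e := pow4_gt0 m e.
have w0 e := ltW (wp e).
pose A := [set e | (m e <= j * g)%N].
pose wA := restrict_weight A w.
pose L u e := w e * lev (wdeg w (x u)) (x u e).
pose LA u e := wA e * lev (wdeg wA (x u)) (x u e).
have L0 u e : 0 <= L u e by apply: lev_wdeg_ge0.
have LAL u e : LA u e <= (1 + eta) * L u e.
  have i4 : 0 <= (4^-1 : R) by rewrite invr_ge0.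
  apply: (@lev_restrict A u e w ((4^-1) ^+ (j * g)) ((4^-1) ^+ (j.+1 * g)) eta) => //.
  - move=> f; rewrite inE => fA; apply: ler_wiXn2l => //; lra.
  - move=> f; rewrite inE -ltnNge => /jgap fA.
    by apply: ler_wiXn2l => //; [lra | exact: ltnW].
  - by rewrite exprn_gt0 // invr_gt0.
  - by rewrite exprn_ge0.
  - exact: ltW.
  rewrite mulSn exprD; have := exprn_ge0 (j * g) i4; nra.
have sumL u : \sum_e L u e = (\rank (wdeg w (x u)))%:R := sum_lev (x u) w.
have sumLA u : \sum_e LA u e = (\rank (wdeg wA (x u)))%:R := sum_lev (x u) wA.
have rankle w' : \sum_u (\rank (wdeg w' (x u)))%:R <= N.
  rewrite /N natrM mulr_natl -[leRHS]sumr_const; apply: ler_sum => u _.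
  by rewrite ler_nat rank_leq_row.
(* Each edge of [P] has a score above [t / 4] at some vertex, so the total of the scores limits the
   size of [P]. *)
have cnt (P : {set E}) : (forall e, e \in P -> (0 < m e)%N) ->
    #|P|%:R * t <= 4 * \sum_u \sum_(e in P) L u e.
  move=> Pm; rewrite exchange_big mulr_sumr -sumr_const mulr_suml /=.
  apply: ler_sum => e eP; have [u hu] := mbig e (Pm e eP).
  have := ler_term_sum (F := fun u => L u e) u (fun u => L0 u e).
  by rewrite /L; move: hu; rewrite -/w; lra.
(* Deleted edges get denominator 0, which encodes the scaling [1 / 0 = 0]. *)
exists (fun e => if e \in A then (2 ^ m e)%N else 0%N) => w'.
have w'E : w' = wA.
  apply: boolp.funext => e; rewrite /w' /wA /restrict_weight.
  case: ifP => _; last by rewrite invr0 expr0n.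
  rewrite /w /pow4 natrX -exprVn -exprM mulnC exprM.
  by rewrite [_^-1 ^+ 2]exprVn -natrX.
rewrite w'E; split.
- move=> u e; rewrite -/(LA u e).
  have [eA|eA] := boolP (e \in A); last first.
    by rewrite /LA /wA /restrict_weight (negPf eA) mul0r ltW.
  apply: le_trans (LAL u e) _; rewrite -tE ler_pM2l; last lra.
  apply: mlev; move: eA; rewrite inE => /leq_ltn_trans; apply.
  by rewrite ltn_pmul2r // ltnS.
- set P := [set e | _].
  have Pm e : e \in P -> (0 < m e)%N.
    by rewrite inE; case: ifP => // _; case: (m e).
  have le1 : \sum_u \sum_(e in P) L u e <= N.
    apply: le_trans (rankle w); apply: ler_sum => u _; rewrite -sumL.
    by rewrite big_mkcond; apply: ler_sum => e _; case: ifP.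
  (* Here [q * t <= 4 * N], and passing from [t] to [tau] costs a factor [1 + eta <= 2]. *)
  have := cnt P Pm; set q := #|P|%:R; have : 0 <= q by rewrite ler0n.
  by rewrite -tE; nra.
set Z := [set e | _]; have ZE : Z = ~: A.
  apply/setP => e; rewrite !inE; case: ifP => //= _.
  by rewrite expn_eq0.
have Zm e : e \in Z -> (0 < m e)%N.
  by rewrite ZE !inE -ltnNge; apply: leq_ltn_trans.
have rankE u : \rank (wdeg (fun=> 1) (x u)) = \rank (wdeg w (x u)).
  by apply/eqP; rewrite eqn_leq !rank_wdeg_le // => e _; rewrite ?ltr01 ?ler01.
under eq_bigr do rewrite rankE.
rewrite -!natr_sum; set r0 := (\sum_u _)%N; set r1 := (\sum_u _)%N.
have r10 : (r1 <= r0)%N.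
  apply: leq_sum => u _; apply: rank_wdeg_le => // e _; exact: wp.
pose Q := \sum_u \sum_(e in A) L u e.
have Qr1 : r1%:R <= (1 + eta) * Q.
  rewrite natr_sum mulr_sumr; apply: ler_sum => u _; rewrite -sumLA mulr_sumr.
  rewrite [leRHS]big_mkcond; apply: ler_sum => e _; case: ifPn => eA //.
  by rewrite /LA /wA /restrict_weight (negPf eA) mul0r.
have Qr0 : \sum_u \sum_(e in Z) L u e = r0%:R - Q.
  rewrite natr_sum /Q -sumrB; apply: eq_bigr => u _; rewrite -sumL.
  rewrite [X in X - _](bigID (mem A)) /= addrAC subrr add0r.
  by apply: eq_bigl => e; rewrite ZE inE.
have cZ := cnt Z Zm; rewrite Qr0 in cZ.
have r1N : r1%:R <= N by rewrite natr_sum.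
have r1p : 0 <= r1%:R :> R by [].
(* From [(1 + eta) * Q >= r1] follows [Q >= r1 - eta * N], which bounds the scores [r0 - Q] of the
   deleted edges. *)
have key : #|Z|%:R * tau <= 4 * ((1 + eta) * (r0%:R - r1%:R + eta * N)).
  rewrite -tE; nra.
(* Ranks are integers. If the rank does not drop, the error term alone is less than [tau], so [Z] is
   empty; otherwise the drop is at least 1 and absorbs the error when 4 is relaxed to 8. *)
move: r10; rewrite leq_eqVlt => /predU1P[r10|].
  rewrite r10 subrr mulr0 add0r in key *.
  have [->|Zp] := posnP #|Z|; first by rewrite mul0r.
  have : 1 <= #|Z|%:R :> R by rewrite ler1n.
  nra.
rewrite -(ler_nat R) -natr1 => d1; nra.
Qed.

End Existence.

(** * Leverage scores by elimination *)

Section Elimination.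
Variables (R : realType) (n k : nat) (y : nat -> 'I_n -> R).
Variable M : nat -> nat -> nat -> R.
Hypothesis M0 : forall a b, (a <= k)%N -> (b <= k)%N ->
  M 0 a b = \sum_w y a w * y b w.
Hypothesis MS : forall p a b, (p < k)%N -> (a <= k)%N -> (b <= k)%N ->
  M p.+1 a b = M p a b - M p a p * M p p b / M p p p.

(* [Y a] is [y a] minus its projection onto [y 0, ..., y (p - 1)]. *)
Lemma elimination_invariant p : (p <= k)%N ->
  exists (Y : nat -> 'I_n -> R) (c : nat -> 'I_k -> R),
    [/\ forall a b, (a <= k)%N -> (b <= k)%N -> M p a b = \sum_w Y a w * Y b w,
        forall a b, (a <= k)%N -> (b <= k)%N -> M p a b = \sum_w Y a w * y b w,
        forall a w, (a <= k)%N -> Y a w = y a w - \sum_j c a j * y j w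
      & forall a i, (a <= k)%N -> (i < p)%N -> M p a i = 0].
Proof.
elim: p => [_|p IH pk].
  exists y, (fun _ _ => 0); split=> // a w _.
  by rewrite big1 ?subr0 // => j _; rewrite mul0r.
have [Y [c [MY My Yc Mz]]] := IH (ltnW pk).
pose q a := M p a p / M p p p; pose j0 := Ordinal pk.
exists (fun a w => Y a w - q a * Y p w).
(* These coefficients come from expanding [Y a - q a * Y p], where [y p] itself enters with
   coefficient [q a]. *)
exists (fun a j => c a j + q a * ((j == j0)%:R - c p j)).
have pk' := ltnW pk.
have Msym a b : (a <= k)%N -> (b <= k)%N -> M p a b = M p b a.
  by move=> ak bk; rewrite !MY //; apply: eq_bigr => w _; rewrite mulrC.
(* A zero pivot means [Y p = 0], so its whole column vanishes. Division by zero gives 0, and such an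
   elimination step changes nothing. *)
have Mpp0 a : (a <= k)%N -> M p p p = 0 -> M p a p = 0.
  move=> ak h; rewrite MY // big1 // => w _.
  have /psumr_eq0P : forall w, xpredT w -> 0 <= Y p w * Y p w.
    by move=> w' _; rewrite -expr2 sqr_ge0.
  rewrite -MY // => /(_ h w isT)/eqP; rewrite mulf_eq0 orbb => /eqP ->.
  by rewrite mulr0.
split.
- move=> a b ak bk; rewrite MS // (Msym p b) //.
  transitivity (M p a b - q b * M p a p - q a * M p b p
                + q a * q b * M p p p).
    rewrite /q; have [z|z] := eqVneq (M p p p) 0; last by field.
    by rewrite z invr0 !mulr0; ring.
  rewrite !MY // !mulr_sumr -!sumrB -big_split; apply: eq_bigr => w _ /=; ring.
- move=> a b ak bk; rewrite MS // [M p a b]My // [M p p b]My //.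
  rewrite mulrAC mulr_sumr -sumrB; apply: eq_bigr => w _; rewrite /q; ring.
- move=> a w ak; rewrite !Yc //.
  have -> : \sum_j (c a j + q a * ((j == j0)%:R - c p j)) * y j w
      = \sum_j c a j * y j w + q a * (y p w - \sum_j c p j * y j w).
    have -> : y p w = \sum_j (j == j0)%:R * y j w.
      rewrite (bigD1 j0) //= eqxx mul1r big1 ?addr0 // => j /negPf ->.
      by rewrite mul0r.
    rewrite -sumrB mulr_sumr -big_split; apply: eq_bigr => j _ /=; ring.
  ring.
- move=> a i ak; rewrite ltnS leq_eqVlt => /predU1P[->|ip].
    rewrite MS //; have [z|z] := eqVneq (M p p p) 0; last by field.
    by rewrite z invr0 mulr0 subr0 Mpp0.
  have ik : (i <= k)%N by rewrite (leq_trans (ltnW ip)).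
  by rewrite MS // (Mz a i) // (Mz p i) // mulr0 mul0r subrr.
Qed.

(** The residual of the indicator row is [r = e_v - (cv . x_w)_w]. Its orthogonality to the first
    [k] rows says [D cv = x_v], so the score is [cv . x_v = 1 - r_v], while the last pivot is
    [r . e_v = r_v]. *)
Lemma elimination_lev (x : 'I_n -> 'cV[R]_k) (v : 'I_n) :
    (forall (i : 'I_k) w, y i w = x w i 0) ->
    (forall w, y k w = (w == v)%:R) ->
  1 - M k k k = lev (wdeg (fun=> 1) x) (x v).
Proof.
move=> yx yk; have [Y [c [_ My Yc Mz]]] := elimination_invariant (leqnn k).
pose r := Y k; pose cv : 'cV[R]_k := \col_j c k j.
have rE w : r w = (w == v)%:R - dotc cv (x w).
  rewrite /r Yc // yk dotcE; congr (_ - _); apply: eq_bigr => j _.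
  by rewrite mxE yx.
have delta (F : 'I_n -> R) : \sum_w (w == v)%:R * F w = F v.
  rewrite (bigD1 v) //= eqxx mul1r big1 ?addr0 // => w /negPf ->.
  by rewrite mul0r.
have xE : wdeg (fun=> 1) x *m cv = x v.
  apply/colP => i; have := My k i (leqnn k) (ltnW (ltn_ord i)).
  rewrite Mz // => /esym; under eq_bigr do rewrite -/r rE yx mulrBl.
  rewrite sumrB delta => /subr0_eq ->; rewrite wdeg_mul summxE.
  by apply: eq_bigr => w _; rewrite mul1r mxE dotcC.
rewrite -xE lev_quad // xE My //.
under eq_bigr do rewrite -/r yk mulrC.
by rewrite delta rE eqxx subKr.
Qed.

End Elimination.

(** * Loops *)

Fixpoint nwrites (c : cmd) (a : nat) : bool :=
  match c with
  | NSet b _ _ => b == a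
  | Seq c d | If _ c d => nwrites c a || nwrites d a
  | While _ c => nwrites c a
  | _ => false
  end.

Fixpoint rwrites (c : cmd) (a : nat) : bool :=
  match c with
  | RSet b _ _ => b == a
  | Seq c d | If _ c d => rwrites c a || rwrites d a
  | While _ c => rwrites c a
  | _ => false
  end.

Lemma exec_frame (R : realType) c (st st' : state R) : exec c st st' ->
  (forall a, ~~ nwrites c a -> nmem st' a =1 nmem st a) /\
  (forall a, ~~ rwrites c a -> rmem st' a =1 rmem st a).
Proof.
elim=> {c st st'} //=.
- by move=> st a i e; split=> // b nab j; rewrite /upd eq_sym (negPf nab).
- by move=> st a i e; split=> // b nab j; rewrite /upd eq_sym (negPf nab).
- move=> c d s1 s2 s3 _ [n1 r1] _ [n2 r2].
  split=> a; rewrite negb_or => /andP[ca da] j.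
    by rewrite n2 // n1.
  by rewrite r2 // r1.
- move=> b c d s s' _ _ [n1 r1].
  by split=> a; rewrite negb_or => /andP[ca da] j; rewrite ?n1 ?r1.
- move=> b c d s s' _ _ [n1 r1].
  by split=> a; rewrite negb_or => /andP[ca da] j; rewrite ?n1 ?r1.
- move=> b c s1 s2 s3 _ _ [n1 r1] _ [n2 r2].
  by split=> a ca j; rewrite ?n2 ?n1 ?r2 ?r1.
Qed.

Definition nvar (a : nat) : nexp := NGet a (NConst 0).
Definition rvar (a : nat) : rexp := RGet a (NConst 0).

(* The counter of every loop is cell 0 of the natural array 2. *)
Definition For (N : nexp) (c : cmd) : cmd :=
  Seq (NSet 2 (NConst 0) (NConst 0))
      (While (BLtN (nvar 2) N)
             (Seq c (NSet 2 (NConst 0) (NAdd (nvar 2) (NConst 1))))).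

Definition FillN (a : nat) (N e : nexp) : cmd := For N (NSet a (nvar 2) e).
Definition FillR (a : nat) (N : nexp) (e : rexp) : cmd :=
  For N (RSet a (nvar 2) e).

Definition SumN (a : nat) (N e : nexp) : cmd :=
  Seq (NSet a (NConst 0) (NConst 0))
      (For N (NSet a (NConst 0) (NAdd (nvar a) e))).
Definition SumR (a : nat) (N : nexp) (e : rexp) : cmd :=
  Seq (RSet a (NConst 0) (RNat (NConst 0)))
      (For N (RSet a (NConst 0) (RAdd (rvar a) e))).

Section Loops.
Variable R : realType.
Implicit Types (st : state R) (N : nat).

Definition set_counter st i := State (upd (nmem st) 2 0 i) (rmem st).

(** Induction on the number of passes left. The bound is evaluated anew at each pass, so the
    invariant has to determine its value, and the body has to preserve the counter. *)
Lemma for_exec Ne c N (I : nat -> state R -> Prop) st :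
    (forall i st', I i st' -> neval st' Ne = N) ->
    I 0%N (set_counter st 0) ->
    (forall i st', (i < N)%N -> nmem st' 2 0 = i -> I i st' ->
       exists2 st'', exec c st' st'' &
         nmem st'' 2 0 = i /\ I i.+1 (set_counter st'' i.+1)) ->
  exists2 st', exec (For Ne c) st st' & I N st'.
Proof.
move=> hN I0 step.
suff loop r i st1 : (i + r)%N = N -> nmem st1 2 0 = i -> I i st1 ->
    exists2 st', exec (While (BLtN (nvar 2) Ne)
      (Seq c (NSet 2 (NConst 0) (NAdd (nvar 2) (NConst 1))))) st1 st' & I N st'.
  have [|||st' ex' I'] // := loop N 0%N (set_counter st 0).
  by exists st' => //; apply: ESeq ex'; exact: ENSet.
elim: r i st1 => [|r IH] i st1 ir ti Ii.
  exists st1; last by rewrite -ir addn0.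
  by apply: EWhileF; rewrite /= (hN _ _ Ii) ti -ir addn0 ltnn.
have iN : (i < N)%N by rewrite -ir addnS ltnS leq_addr.
have [st2 ex2 [t2 I2]] := step i st1 iN ti Ii.
have [|||st3 ex3 I3] // := IH i.+1 (set_counter st2 i.+1).
  by rewrite addSnnS.
exists st3 => //; apply: EWhileT ex3; first by rewrite /= (hN _ _ Ii) ti.
apply: ESeq ex2 _.
have -> : i.+1 = (nmem st2 2 0 + 1)%N by rewrite t2 addn1.
exact: ENSet.
Qed.

Definition agree (P Q : pred nat) st st' :=
  (forall b, P b -> nmem st' b =1 nmem st b) /\
  (forall b, Q b -> rmem st' b =1 rmem st b).

(** The expression may read the array being filled, hence the argument [f] of [F]. As cell [i]
    depends only on earlier cells, the recurrence that holds when it is written still holds for the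
    final array. *)
Lemma fillN_exec A Ne e N st (F : (nat -> nat) -> nat -> nat) :
    A != 2 ->
    (forall st', agree [pred b | (b != 2) && (b != A)] predT st st' ->
       neval st' Ne = N) ->
    (forall st' i, (i < N)%N -> nmem st' 2 0 = i ->
       agree [pred b | (b != 2) && (b != A)] predT st st' ->
       neval st' e = F (nmem st' A) i) ->
    (forall f g i, (i < N)%N -> (forall j, (j < i)%N -> f j = g j) ->
       F f i = F g i) ->
  exists2 st', exec (FillN A Ne e) st st' &
    forall i, (i < N)%N -> nmem st' A i = F (nmem st' A) i.
Proof.
move=> A2 hN he causal.
pose I i st' := agree [pred b | (b != 2) && (b != A)] predT st st' /\
  forall j, (j < i)%N -> (j < N)%N -> nmem st' A j = F (nmem st' A) j.
have [||i st1 iN ti [ag ih]|st' ex' [_ h]] := @for_exec Ne (NSet A (nvar 2) e) N I st.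
- by move=> i st' [ag _]; exact: hN.
- by split=> //; split=> // b /andP[b2 _] j; rewrite /= /upd (negPf b2).
- eexists; first exact: ENSet.
  have e1 := he st1 i iN ti ag.
  rewrite /= ti e1; split; first by rewrite /upd eq_sym (negPf A2).
  split; first split=> [b /andP[b2 bA] j|b _ j] //=.
    by rewrite /upd (negPf b2) (negPf bA) /=; apply: ag.1; rewrite /= b2 bA.
  + by rewrite ag.2.
  set g := nmem _ _; have gE j : g j = if j == i then F (nmem st1 A) i else nmem st1 A j.
    by rewrite /g /= /upd (negPf A2) eqxx.
  move=> j; rewrite ltnS leq_eqVlt => jl jN; rewrite gE; case: eqVneq jl => /= [-> _|_ ji].
    by apply: causal => // j' j'i; rewrite gE ltn_eqF.
  rewrite ih //; apply: causal => // j' j'j; rewrite gE ltn_eqF //.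
  exact: ltn_trans ji.
by exists st' => // i iN; apply: h.
Qed.

Lemma fillR_exec A Ne e N st (F : (nat -> R) -> nat -> R) :
    (forall st', agree (predC1 2) (predC1 A) st st' -> neval st' Ne = N) ->
    (forall st' i, (i < N)%N -> nmem st' 2 0 = i ->
       agree (predC1 2) (predC1 A) st st' ->
       reval st' e = F (rmem st' A) i) ->
    (forall f g i, (i < N)%N -> (forall j, (j < i)%N -> f j = g j) ->
       F f i = F g i) ->
  exists2 st', exec (FillR A Ne e) st st' &
    forall i, (i < N)%N -> rmem st' A i = F (rmem st' A) i.
Proof.
move=> hN he causal.
pose I i st' := agree (predC1 2) (predC1 A) st st' /\
  forall j, (j < i)%N -> (j < N)%N -> rmem st' A j = F (rmem st' A) j.
have [||i st1 iN ti [ag ih]|st' ex' [_ h]] := @for_exec Ne (RSet A (nvar 2) e) N I st.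
- by move=> i st' [ag _]; exact: hN.
- by split=> //; split=> // b /= b2 j; rewrite /= /upd (negPf b2).
- eexists; first exact: ERSet.
  have e1 := he st1 i iN ti ag.
  rewrite /= ti e1; split => //.
  split; first split=> [b /= b2 j|b /= bA j] //=.
  + by rewrite /upd (negPf b2) /=; apply: ag.1.
  + by rewrite /upd (negPf bA) /=; apply: ag.2.
  set g := rmem _ _; have gE j : g j = if j == i then F (rmem st1 A) i else rmem st1 A j.
    by rewrite /g /= /upd eqxx.
  move=> j; rewrite ltnS leq_eqVlt => jl jN; rewrite gE; case: eqVneq jl => /= [-> _|_ ji].
    by apply: causal => // j' j'i; rewrite gE ltn_eqF.
  rewrite ih //; apply: causal => // j' j'j; rewrite gE ltn_eqF //.
  exact: ltn_trans ji.
by exists st' => // i iN; apply: h.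
Qed.

Lemma sumN_exec A Ne e N st (f : nat -> nat) :
    A != 2 ->
    (forall st', agree [pred b | (b != 2) && (b != A)] predT st st' ->
       neval st' Ne = N) ->
    (forall st' i, (i < N)%N -> nmem st' 2 0 = i ->
       agree [pred b | (b != 2) && (b != A)] predT st st' ->
       neval st' e = f i) ->
  exists2 st', exec (SumN A Ne e) st st' &
    nmem st' A 0 = (\sum_(i < N) f i)%N.
Proof.
move=> A2 hN he.
pose I i st' := agree [pred b | (b != 2) && (b != A)] predT st st' /\
  nmem st' A 0 = (\sum_(j < i) f j)%N.
pose st0 := State (upd (nmem st) A 0 0%N) (rmem st).
have [||i st1 iN ti [ag ih]|st' ex' [_ h]] :=
  @for_exec Ne (NSet A (NConst 0) (NAdd (nvar A) e)) N I st0.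
- by move=> i st' [ag _]; exact: hN.
- split; last by rewrite big_ord0 /= /upd (negPf A2) !eqxx.
  by split=> // b /andP[b2 bA] j; rewrite /= /upd (negPf b2) (negPf bA).
- eexists; first exact: ENSet.
  rewrite /= (he st1 i iN ti ag) ih; split; first by rewrite /upd eq_sym (negPf A2).
  split; last by rewrite big_ord_recr /= /upd (negPf A2) !eqxx.
  split=> [b /andP[b2 bA] j|b _ j] //=; last by rewrite ag.2.
  by rewrite /upd (negPf b2) (negPf bA) /=; apply: ag.1; rewrite /= b2 bA.
by exists st' => //; apply: ESeq ex'; exact: ENSet.
Qed.

Lemma sumR_exec A Ne e N st (f : nat -> R) :
    (forall st', agree (predC1 2) (predC1 A) st st' -> neval st' Ne = N) ->
    (forall st' i, (i < N)%N -> nmem st' 2 0 = i ->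
       agree (predC1 2) (predC1 A) st st' -> reval st' e = f i) ->
  exists2 st', exec (SumR A Ne e) st st' &
    rmem st' A 0 = \sum_(i < N) f i.
Proof.
move=> hN he.
pose I i st' := agree (predC1 2) (predC1 A) st st' /\
  rmem st' A 0 = \sum_(j < i) f j.
pose st0 := State (nmem st) (upd (rmem st) A 0 0%:R).
have [||i st1 iN ti [ag ih]|st' ex' [_ h]] :=
  @for_exec Ne (RSet A (NConst 0) (RAdd (rvar A) e)) N I st0.
- by move=> i st' [ag _]; exact: hN.
- split; last by rewrite big_ord0 /= /upd !eqxx.
  by split=> b /= bx j; rewrite /upd (negPf bx).
- eexists; first exact: ERSet.
  rewrite /= (he st1 i iN ti ag) ih; split => //.
  split; last by rewrite big_ord_recr /= /upd !eqxx.
  split=> [b /= b2 j|b /= bA j].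
    by rewrite /upd (negPf b2) /=; apply: ag.1.
  by rewrite /upd (negPf bA) /=; apply: ag.2.
by exists st' => //; apply: ESeq ex'; exact: ERSet.
Qed.

End Loops.

(** * Computing leverage scores and ranks *)

Definition eN : nexp := nvar 0.
Definition eK : nexp := NGet 0 (NConst 1).
Definition eK1 : nexp := NAdd eK (NConst 1).
(** The number of slabs for each pair [(u, v)]: [n + 1] partial sums and [k] eliminations. *)
Definition eP : nexp := NAdd (NAdd eN eK) (NConst 1).

(* [1 - (1 - x)] is the indicator of [0 < x]. *)
Definition Npos (x : nexp) : nexp := NSub (NConst 1) (NSub (NConst 1) x).
(** The indicator of equality: both truncated differences vanish only for equal numbers. *)
Definition Neq (x y : nexp) : nexp :=
  NSub (NConst 1) (NAdd (NSub x y) (NSub y x)).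

(* The row of [phi] at [u], scaled and extended by the indicator of [v]:
   cell [zidx n k (u * n + v) w a] of real array 3. *)
Definition evector : rexp :=
  let a := NMod (nvar 2) eK1 in
  let w := NMod (NDiv (nvar 2) eK1) eN in
  let e := NDiv (NDiv (nvar 2) eK1) eN in
  let uw := NAdd (NMul (NDiv e eN) eN) w in
  RAdd (RMul (RNat (Npos (NSub eK a)))
             (RMul (RGet 2 uw) (RGet 1 (NAdd (NMul uw eK) a))))
       (RNat (NMul (NSub (NConst 1) (NSub eK a)) (Neq w (NMod e eN)))).

Definition vectors_prog : cmd :=
  FillR 3 (NMul (NMul (NMul eN eN) eN) eK1) evector.

Definition emidx (e p a b : nexp) : nexp :=
  NAdd (NMul (NAdd (NMul (NAdd (NMul e eP) p) eK1) a) eK1) b.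

(* Slabs 0, ..., n of real array 4 are the partial sums of the Gram matrix of
   the extended vectors; each of the following k slabs eliminates a pivot. *)
Definition egram : rexp :=
  let b := NMod (nvar 2) eK1 in
  let a := NMod (NDiv (nvar 2) eK1) eK1 in
  let p := NMod (NDiv (NDiv (nvar 2) eK1) eK1) eP in
  let e := NDiv (NDiv (NDiv (nvar 2) eK1) eK1) eP in
  let p1 := NSub p (NConst 1) in
  let r := NSub p1 eN in
  let z x := RGet 3 (NAdd (NMul (NAdd (NMul e eN) p1) eK1) x) in
  let m x y := RGet 4 (emidx e p1 x y) in
  RMul (RNat (Npos p))
    (RSub (RAdd (m a b) (RMul (RNat (Npos (NSub eN p1))) (RMul (z a) (z b))))
          (RMul (RNat (NSub (NConst 1) (NSub eN p1)))
                (RDiv (RMul (m a r) (m r b)) (m r r)))).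

Definition gram_prog : cmd :=
  FillR 4 (NMul (NMul (NMul (NMul eN eN) eP) eK1) eK1) egram.

Definition elev : rexp :=
  RSub (RNat (NConst 1)) (RGet 4 (emidx (nvar 2) (NAdd eN eK) eK eK)).

Definition lev_prog : cmd :=
  Seq vectors_prog (Seq gram_prog (SumR 5 (NMul eN eN) elev)).

Definition zidx (n k e w a : nat) : nat := ((e * n + w) * (k + 1) + a)%N.
Definition midx (n k e p a b : nat) : nat :=
  (((e * (n + k + 1) + p) * (k + 1) + a) * (k + 1) + b)%N.

Lemma divn_mod_pair (q d r : nat) : (r < d)%N ->
  ((q * d + r) %/ d = q)%N /\ ((q * d + r) %% d = r)%N.
Proof.
move=> rd; have d0 : (0 < d)%N by apply: leq_ltn_trans rd.
by rewrite divnMDl // modnMDl divn_small // modn_small // addn0.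
Qed.

Lemma ltn_pair (q Q d r : nat) : (q < Q)%N -> (r < d)%N -> (q * d + r < Q * d)%N.
Proof.
move=> qQ rd; apply: (@leq_trans (q.+1 * d)); last by rewrite leq_mul2r qQ orbT.
by rewrite mulSnr ltn_add2l.
Qed.

Lemma ltn_pairl (q Q d r s : nat) : (q < Q)%N -> (r < d)%N ->
  (q * d + r < Q * d + s)%N.
Proof. by move=> qQ rd; rewrite ltn_addr // ltn_pair. Qed.

Lemma subn_pos_ind (m : nat) : (1 - (1 - m) = (0 < m))%N.
Proof. by case: m => // m; rewrite subnS. Qed.

Lemma sum_pairs (T : Type) (idx : T) (op : Monoid.law idx) (m n : nat)
    (F : nat -> T) :
  \big[op/idx]_(t < m * n) F t
    = \big[op/idx]_(u < m) \big[op/idx]_(v < n) F (u * n + v)%N.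
Proof.
elim: m => [|m IH]; first by rewrite !big_ord0.
rewrite big_ord_recr /= -IH -!(big_mkord xpredT F) mulSnr.
rewrite (@big_cat_nat _ _ _ (m * n)) ?leq_addr //=; congr (op _ _).
rewrite -{1}[(m * n)%N]add0n big_addn addKn big_mkord.
by apply: eq_bigr => v _; rewrite addnC.
Qed.

Section LevProg.
Variables (R : realType) (n k : nat).
Implicit Types st : state R.

Definition scaled_row st (u v : 'I_n) : 'cV[R]_k :=
  \col_i (rmem st 2 (u * n + v)%N * rmem st 1 ((u * n + v) * k + i)%N).

Lemma vectors_prog_exec st : nmem st 0 0 = n -> nmem st 0 1 = k ->
  exists2 st', exec vectors_prog st st' &
    forall (u v w : 'I_n),
      (forall i : 'I_k, rmem st' 3 (zidx n k (u * n + v) w i)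
                        = scaled_row st u w i 0) /\
      rmem st' 3 (zidx n k (u * n + v) w k) = (w == v)%:R.
Proof.
move=> hn hk.
pose F (_ : nat -> R) t :=
  let a := (t %% (k + 1))%N in let w := (t %/ (k + 1) %% n)%N in
  let e := (t %/ (k + 1) %/ n)%N in let uw := (e %/ n * n + w)%N in
  (1 - (1 - (k - a)))%N%:R * (rmem st 2 uw * rmem st 1 (uw * k + a)%N)
  + ((1 - (k - a)) * (1 - ((w - e %% n) + (e %% n - w))))%N%:R : R.
have [st' [nag _]|st' i iN ti [nag rag]|//|st' ex' h] :=
  @fillR_exec R 3%N (NMul (NMul (NMul eN eN) eN) eK1) evector
    (n * n * n * (k + 1))%N st F.
- by rewrite /= !nag // hn hk.
- by rewrite /= ti !nag // !rag // hn hk.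
exists st' => // u v w.
  have key a : (a < k + 1)%N -> rmem st' 3 (zidx n k (u * n + v) w a) =
      (a < k)%N%:R * (rmem st 2 (u * n + w)%N * rmem st 1 ((u * n + w) * k + a)%N)
      + ((k <= a)%N && (w == v))%:R.
    move=> ak; rewrite h /F; last by rewrite /zidx !ltn_pair.
    have [e1 e2] := divn_mod_pair ((u * n + v) * n + w) ak.
    have [e3 e4] := divn_mod_pair (u * n + v) (ltn_ord w).
    have [e5 e6] := divn_mod_pair u (ltn_ord v).
    rewrite /zidx e1 e2 e3 e4 e5 e6 subn_pos_ind subn_gt0; congr (_ + _%:R).
    rewrite -(inj_eq val_inj) /=; lia.
  have kk : (k < k + 1)%N by rewrite addn1.
  split=> [i|]; last by rewrite key // ltnn leqnn mul0r add0r.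
  have ik : (i < k + 1)%N := ltn_trans (ltn_ord i) kk.
  by rewrite key // ltn_ord leqNgt ltn_ord mul1r addr0 mxE.
Qed.

(** Cells are filled in increasing order, so a slab may read every entry of an earlier slab; this
    gives the causality that [fillR_exec] asks for. *)
Lemma midx_lt e p p' a a' b b' : (p' < p)%N -> (a' < k + 1)%N -> (b' < k + 1)%N ->
  (midx n k e p' a' b' < midx n k e p a b)%N.
Proof.
move=> pp aa bb; rewrite /midx; apply: ltn_pairl => //; apply: ltn_pairl => //.
by rewrite ltn_add2l.
Qed.

Lemma gram_prog_exec st : nmem st 0 0 = n -> nmem st 0 1 = k ->
  exists2 st', exec gram_prog st st' &
    forall e a b, (e < n * n)%N -> (a < k + 1)%N -> (b < k + 1)%N ->
    let m p a b := rmem st' 4 (midx n k e p a b) in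
    [/\ m 0 a b = 0,
        forall p, (p < n)%N -> m p.+1 a b =
          m p a b + rmem st 3 (zidx n k e p a) * rmem st 3 (zidx n k e p b)
      & forall p, (p < k)%N -> m (n + p.+1)%N a b = m (n + p)%N a b
          - m (n + p)%N a p * m (n + p)%N p b / m (n + p)%N p p].
Proof.
move=> hn hk.
(* The indicators select 0 for [p = 0], accumulation of a vector for [0 < p <= n], and beyond that
   elimination with pivot index [r = p - 1 - n]. *)
pose H (f : nat -> R) e p a b :=
  let p1 := (p - 1)%N in let r := (p1 - n)%N in
  let z x := rmem st 3 (zidx n k e p1 x) in
  let m x y := f (midx n k e p1 x y) in
  (1 - (1 - p))%N%:R *
    (m a b + (1 - (1 - (n - p1)))%N%:R * (z a * z b)
     - (1 - (n - p1))%N%:R * (m a r * m r b / m r r)).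
pose F f t := H f (t %/ (k + 1) %/ (k + 1) %/ (n + k + 1))%N
  (t %/ (k + 1) %/ (k + 1) %% (n + k + 1))%N
  (t %/ (k + 1) %% (k + 1))%N (t %% (k + 1))%N.
have decode e p a b : (p < n + k + 1)%N -> (a < k + 1)%N -> (b < k + 1)%N ->
    forall f, F f (midx n k e p a b) = H f e p a b.
  move=> pP ak bk f; rewrite /F; set t := midx _ _ _ _ _ _.
  have [e1 e2] : (t %/ (k + 1) = (e * (n + k + 1) + p) * (k + 1) + a)%N /\
    (t %% (k + 1) = b)%N := divn_mod_pair _ bk.
  have [e3 e4] := divn_mod_pair (e * (n + k + 1) + p) ak.
  have [e5 e6] := divn_mod_pair e pP.
  by rewrite e2 e1 e4 e3 e5 e6.
have k1 : (0 < k + 1)%N by rewrite addn1.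
have P0 : (0 < n + k + 1)%N by rewrite addn1.
have [st' [nag _]|st' i iN ti [nag rag]|f g t tN fg|st' ex' h] :=
  @fillR_exec R 4%N (NMul (NMul (NMul (NMul eN eN) eP) eK1) eK1) egram
    (n * n * (n + k + 1) * (k + 1) * (k + 1))%N st F.
- by rewrite /= !nag // hn hk.
- by rewrite /= ti !nag // !(rag 3%N) // hn hk.
- have tE : t = midx n k (t %/ (k + 1) %/ (k + 1) %/ (n + k + 1))
      (t %/ (k + 1) %/ (k + 1) %% (n + k + 1))
      (t %/ (k + 1) %% (k + 1)) (t %% (k + 1)).
    by rewrite /midx -!divn_eq.
  have pP : (t %/ (k + 1) %/ (k + 1) %% (n + k + 1) < n + k + 1)%N by rewrite ltn_mod.
  have aK : (t %/ (k + 1) %% (k + 1) < k + 1)%N by rewrite ltn_mod.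
  have bK : (t %% (k + 1) < k + 1)%N by rewrite ltn_mod.
  move: tE pP aK bK fg; rewrite /F.
  move: (t %/ _ %/ _ %/ _)%N (_ %% (n + k + 1))%N (t %/ _ %% _)%N (t %% _)%N.
  move=> e p a b -> pP aK bK fg; rewrite /H.
  (* For [p = 0] truncation makes the previous slab the current one; the leading factor 0 cancels
     whatever is read there. *)
  have [->|p0] := posnP p; first by rewrite !mul0r.
  have rK : (p - 1 - n < k + 1)%N by lia.
  by rewrite !fg //; apply: midx_lt => //; lia.
exists st' => // e a b en ak bk m.
have mE p : (p < n + k + 1)%N -> m p a b = H (rmem st' 4) e p a b.
  by move=> pP; rewrite /m h ?decode // /midx !ltn_pair.
split=> [|p pn|p pk].
- by rewrite mE // /H mul0r.
- rewrite mE; last by lia.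
  rewrite /H subn1 /=; have -> : (1 - (1 - (n - p)) = 1)%N by lia.
  have -> : (1 - (n - p) = 0)%N by lia.
  by rewrite subn0 mul1r mul0r subr0 mul1r.
rewrite mE; last by lia.
rewrite /H; have -> : (n + p.+1 - 1 = n + p)%N by lia.
have -> : (1 - (1 - (n + p.+1)) = 1)%N by lia.
have -> : (1 - (1 - (n - (n + p))) = 0)%N by lia.
have -> : (1 - (n - (n + p)) = 1)%N by lia.
by rewrite addKn !mul1r mul0r addr0.
Qed.

Lemma lev_prog_exec st : nmem st 0 0 = n -> nmem st 0 1 = k ->
  let L u v := lev (wdeg (fun=> 1) (scaled_row st u)) (scaled_row st u v) in
  exists2 st', exec lev_prog st st' &
    (forall u v : 'I_n, 1 - rmem st' 4 (midx n k (u * n + v) (n + k) k k) = L u v)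
    /\ rmem st' 5 0 = \sum_u (\rank (wdeg (fun=> 1) (scaled_row st u)))%:R.
Proof.
move=> hn hk L.
have [st1 ex1 h1] := vectors_prog_exec hn hk.
have [f1 _] := exec_frame ex1.
have [||st2 ex2 h2] := @gram_prog_exec st1; rewrite ?f1 //.
have [f2 _] := exec_frame ex2.
have lev2 (u v : 'I_n) :
    1 - rmem st2 4 (midx n k (u * n + v) (n + k) k k) = L u v.
  set e := (u * n + v)%N; have en : (e < n * n)%N by rewrite ltn_pair.
  have kk : (k < k + 1)%N by rewrite addn1.
  pose y a (w : 'I_n) := rmem st1 3 (zidx n k e w a).
  pose M p a b := rmem st2 4 (midx n k e (n + p) a b).
  apply: (@elimination_lev R n k y M).
  - move=> a b; rewrite -ltnS -[k.+1]addn1 => ak.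
    rewrite -ltnS -[k.+1]addn1 => bk.
    have [m0 mS _] := h2 e a b en ak bk.
    suff gram p : (p <= n)%N -> rmem st2 4 (midx n k e p a b) =
        \sum_(w < p) rmem st1 3 (zidx n k e w a) * rmem st1 3 (zidx n k e w b).
      by rewrite /M addn0 gram.
    elim: p => [_|p IH pn]; first by rewrite big_ord0.
    by rewrite mS // IH 1?ltnW // big_ord_recr.
  - move=> p a b pk; rewrite -ltnS -[k.+1]addn1 => ak.
    rewrite -ltnS -[k.+1]addn1 => bk.
    by have [_ _ mS] := h2 e a b en ak bk; exact: mS.
  - by move=> i w; have [h _] := h1 u v w; exact: h.
  by move=> w; have [_ h] := h1 u v w; exact: h.
have [st3 [nag _]|st3 i iN ti [nag rag]|st3 ex3 h3] :=
  @sumR_exec R 5%N (NMul eN eN) elev (n * n)%N st2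
    (fun t => 1 - rmem st2 4 (midx n k t (n + k) k k)).
- by rewrite /= !nag // f2 // f1 // hn.
- by rewrite /= ti !nag // !rag // !f2 // !f1 // hn hk.
have [f3 r3] := exec_frame ex3.
exists st3; first exact: ESeq ex1 (ESeq ex2 ex3).
split=> [u v|]; first by rewrite r3.
rewrite h3 (sum_pairs +%R n n (fun t => 1 - rmem st2 4 (midx n k t (n + k) k k))).
apply: eq_bigr => u _.
under eq_bigr do rewrite lev2.
by rewrite -sum_lev; apply: eq_bigr => v _; rewrite mul1r.
Qed.

End LevProg.

(** * Checking a candidate *)

Definition eu : nexp := NDiv (nvar 2) eN.
Definition ev : nexp := NMod (nvar 2) eN.
Definition enn : nexp := NMul eN eN.

(** Cell 0 receives the code [c] and each later cell the quotient of its predecessor by [B], so cell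
    [t] holds [c / B^t]. *)
Definition equot : nexp :=
  NAdd (NMul (NSub (NConst 1) (nvar 2)) (nvar 4))
       (NMul (Npos (nvar 2))
             (NDiv (NGet 5 (NSub (nvar 2) (NConst 1))) (nvar 3))).

(** The cell read has coordinates [min u v] and [max u v], written with truncated subtraction, so
    both orientations of an edge share a digit. *)
Definition edigit : nexp :=
  NMod (NGet 5 (NAdd (NMul (NSub eu (NSub eu ev)) eN)
                     (NAdd eu (NSub ev eu))))
       (nvar 3).

(* With base B and code c in natural arrays 3 and 4, writes the denominators
   [digit n B c u v] to natural array 6 and their inverses to real array 2. *)
Definition digits_prog : cmd :=
  Seq (FillN 5 enn equot)
      (Seq (FillN 6 enn edigit)
           (FillR 2 enn (RDiv (RNat (NConst 1)) (RNat (NGet 6 (nvar 2)))))).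

Definition eedge : nexp := NMul (Npos (NSub ev eu)) (NGet 1 (nvar 2)).

(** By truncation [1 - d] is the indicator of [d = 0], and [1 - (2 - d)] that of [1 < d]. *)
Definition count_prog : cmd :=
  Seq (SumN 7 enn (NMul eedge (NSub (NConst 1) (NGet 6 (nvar 2)))))
      (SumN 8 enn (NMul eedge (NSub (NConst 1)
                                    (NSub (NConst 2) (NGet 6 (nvar 2)))))).

Definition bviol : bexp :=
  BLtR (RMul (rvar 0) (RNat eK)) (RMul elev (RNat eN)).

Definition violation_prog : cmd :=
  Seq (NSet 9 (NConst 0) (NConst 0))
      (For enn (If bviol (NSet 9 (NConst 0) (NConst 1)) Skip)).

(** The three conditions with denominators cleared. Real cells 5 and 6 hold the total ranks of the
    candidate and of the unscaled graph. *)
Definition baccept : bexp :=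
  BAnd (BLtN (nvar 9) (NConst 1))
    (BAnd
      (BNot (BLtR (RMul (RMul (RNat (NConst 8)) (RNat eN)) (RSub (rvar 6) (rvar 5)))
                  (RMul (RNat (nvar 7)) (RMul (rvar 0) (RNat eK)))))
      (BNot (BLtR (RNat (NMul (NConst 8) enn)) (RMul (RNat (nvar 8)) (rvar 0))))).

Definition accept_prog : cmd :=
  If baccept (NSet 10 (NConst 0) (NConst 1)) (NSet 10 (NConst 0) (NConst 0)).

Definition check_prog : cmd :=
  Seq digits_prog
      (Seq lev_prog (Seq count_prog (Seq violation_prog accept_prog))).

Definition digit (n B c u v : nat) : nat :=
  (c %/ B ^ (minn u v * n + maxn u v) %% B)%N.

Lemma digit_sym n B c u v : digit n B c u v = digit n B c v u.
Proof. by rewrite /digit minnC maxnC. Qed.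

Lemma digits_prog_exec (R : realType) n (st : state R) B c :
    nmem st 0 0 = n -> nmem st 3 0 = B -> nmem st 4 0 = c ->
  exists2 st', exec digits_prog st st' &
    forall u v : 'I_n,
      nmem st' 6 (u * n + v)%N = digit n B c u v /\
      rmem st' 2 (u * n + v)%N = (digit n B c u v)%:R^-1.
Proof.
move=> hn hB hc.
pose F1 (f : nat -> nat) t :=
  ((1 - t) * c + (1 - (1 - t)) * (f (t - 1) %/ B))%N.
have [//|st1 [nag _]|st1 i iN ti [nag _]|f g [|i] iN fg|st1 ex1 h1] :=
  @fillN_exec R 5%N enn equot (n * n)%N st F1.
- by rewrite /= !nag // hn.
- by rewrite /= ti !(nag 3%N) // !(nag 4%N) // hB hc.
- by rewrite /F1 !mul0n.
- by rewrite /F1 fg // subn1.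
have q1 t : (t < n * n)%N -> nmem st1 5 t = (c %/ B ^ t)%N.
  elim: t => [|t IH] tn; rewrite h1 // /F1.
    by rewrite expn0 divn1 mul1n mul0n addn0.
  rewrite subn1 /= IH 1?ltnW // expnSr divnMA.
  by rewrite !subSS !sub0n subn0 mul0n mul1n add0n.
have [n1 _] := exec_frame ex1.
pose F2 (_ : nat -> nat) t := (nmem st1 5 ((t %/ n - (t %/ n - t %% n)) * n
  + (t %/ n + (t %% n - t %/ n))) %% B)%N.
have [//|st2 [nag _]|st2 i iN ti [nag _]|//|st2 ex2 h2] :=
  @fillN_exec R 6%N enn edigit (n * n)%N st1 F2.
- by rewrite /= !nag // n1 // hn.
- by rewrite /= ti !nag // !(n1 0%N) // !(n1 3%N) // hn hB.
have [n2 _] := exec_frame ex2.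
pose F3 (_ : nat -> R) t : R := 1%:R / (nmem st2 6 t)%:R.
have [st3 [nag _]|st3 i iN ti [nag _]|//|st3 ex3 h3] :=
  @fillR_exec R 2%N enn (RDiv (RNat (NConst 1)) (RNat (NGet 6 (nvar 2))))
    (n * n)%N st2 F3.
- by rewrite /= !nag // n2 // n1 // hn.
- by rewrite /= ti !nag.
have [n3 _] := exec_frame ex3.
exists st3; first exact: ESeq ex1 (ESeq ex2 ex3).
move=> u v; have uv : (u * n + v < n * n)%N by rewrite ltn_pair.
have d2 : nmem st2 6 (u * n + v)%N = digit n B c u v.
  rewrite h2 // /F2; have [-> ->] := divn_mod_pair u (ltn_ord v).
  rewrite -minnE -maxnE q1 // ltn_pair //; last by rewrite gtn_max !ltn_ord.
  exact: leq_ltn_trans (geq_minl _ _) (ltn_ord u).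
by rewrite n3 // d2 h3 // /F3 d2 mul1r.
Qed.

Section Check.
Variables (R : realType) (n k : nat) (G : mwgraph R n k) (gamma : R).
Implicit Types st : state R.

Definition edge_vec (u v : 'I_n) : 'cV[R]_k := if adj G u v then phi G u v else 0.

Definition denom_row (d : 'I_n -> 'I_n -> nat) (u v : 'I_n) : 'cV[R]_k :=
  (d u v)%:R^-1 *: edge_vec u v.

Definition denom_rank (d : 'I_n -> 'I_n -> nat) : R :=
  \sum_u (\rank (wdeg (fun=> 1) (denom_row d u)))%:R.

Definition input_ok st :=
  [/\ nmem st 0 0 = n, nmem st 0 1 = k,
      forall u v : 'I_n, nmem st 1 (u * n + v)%N = adj G u v,
      rmem st 0 0 = gamma
    & forall (u v : 'I_n) (i : 'I_k),
        rmem st 1 ((u * n + v) * k + i)%N = edge_vec u v i 0].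

(** All pairs are tested, not only edges: the vector of a non-edge is 0 and so is its score. *)
Definition acceptable (d : 'I_n -> 'I_n -> nat) : bool :=
  [&& [forall u, forall v, lev (wdeg (fun=> 1) (denom_row d u)) (denom_row d u v)
                           * n%:R <= gamma * k%:R],
      #|[set p in edges G | d p.1 p.2 == 0%N]|%:R * (gamma * k%:R)
        <= 8 * n%:R * (denom_rank (fun _ _ => 1%N) - denom_rank d)
    & #|[set p in edges G | (1 < d p.1 p.2)%N]|%:R * gamma <= (8 * (n * n))%:R].

Lemma input_ok_frame c st st' :
    ~~ [|| nwrites c 0, nwrites c 1, rwrites c 0 | rwrites c 1] ->
  exec c st st' -> input_ok st -> input_ok st'.
Proof.
rewrite !negb_or => /and4P[c1 c2 c3 c4] /exec_frame[nf rf] [h1 h2 h3 h4 h5].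
by split=> *; rewrite ?nf ?rf.
Qed.

Lemma init_input_ok : input_ok (init_state gamma G).
Proof.
split=> // [u v|u v i]; first exact: init_adjE.
rewrite /edge_vec; case: ifP => uv; first exact: init_phiE.
have n0 : (0 < n)%N by apply: leq_ltn_trans (ltn_ord u).
have [e1 e2] := divn_mod_pair (u * n + v) (ltn_ord i).
have [e3 e4] := divn_mod_pair u (ltn_ord v).
by rewrite /= e1 e2 e3 e4 /ext_ord !valK /= uv mxE.
Qed.

Lemma lev_prog_denom st (d : 'I_n -> 'I_n -> nat) : input_ok st ->
    (forall u v : 'I_n, rmem st 2 (u * n + v)%N = (d u v)%:R^-1) ->
  exists2 st', exec lev_prog st st' &
    (forall u v : 'I_n, 1 - rmem st' 4 (midx n k (u * n + v) (n + k) k k)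
       = lev (wdeg (fun=> 1) (denom_row d u)) (denom_row d u v))
    /\ rmem st' 5 0 = denom_rank d.
Proof.
move=> [hn hk _ _ hphi] hs.
have rowE u v : scaled_row k st u v = denom_row d u v.
  by apply/colP => i; rewrite !mxE hs hphi.
have wE u : wdeg (fun=> 1) (scaled_row k st u) = wdeg (fun=> 1) (denom_row d u).
  by apply: eq_bigr => v _; rewrite rowE.
have [st' ex' [h1 h2]] := lev_prog_exec hn hk.
exists st' => //; split=> [u v|]; first by rewrite h1 wE rowE.
by rewrite h2; apply: eq_bigr => u _; rewrite wE.
Qed.

Lemma count_edges (P : rel 'I_n) :
  (\sum_(u < n) \sum_(v < n) (u < v) * adj G u v * P u v
   = #|[set p in edges G | P p.1 p.2]|)%N.
Proof.
rewrite pair_big /= -sum1_card [RHS]big_mkcond /=; apply: eq_bigr => -[u v] _.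
by rewrite !inE /=; case: ltnP; case: adj; case: P.
Qed.

Lemma count_prog_exec st (d : 'I_n -> 'I_n -> nat) : input_ok st ->
    (forall u v : 'I_n, nmem st 6 (u * n + v)%N = d u v) ->
  exists2 st', exec count_prog st st' &
    nmem st' 7 0 = #|[set p in edges G | d p.1 p.2 == 0%N]| /\
    nmem st' 8 0 = #|[set p in edges G | (1 < d p.1 p.2)%N]|.
Proof.
move=> [hn _ hadj _ _] hd.
pose f (q : nat -> nat) t :=
  ((1 - (1 - (t %% n - t %/ n))) * nmem st 1 t * q (nmem st 6 t))%N.
have fE (q : nat -> nat) (P : pred nat) : (forall m, q m = P m) ->
    (\sum_(t < n * n) f q t = #|[set p in edges G | P (d p.1 p.2)]|)%N.
  move=> qP; rewrite (sum_pairs addn n n (f q)) -(count_edges (fun u v => P (d u v))).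
  apply: eq_bigr => u _; apply: eq_bigr => v _; rewrite /f.
  have [-> ->] := divn_mod_pair u (ltn_ord v).
  by rewrite subn_pos_ind subn_gt0 hadj hd qP.
have [//|st1 [nag _]|st1 i iN ti [nag _]|st1 ex1 h1] :=
  @sumN_exec R 7%N enn (NMul eedge (NSub (NConst 1) (NGet 6 (nvar 2))))
    (n * n)%N st (f (fun m => 1 - m)%N).
- by rewrite /= !nag // hn.
- by rewrite /= ti !nag // hn.
have [n1 _] := exec_frame ex1.
have [//|st2 [nag _]|st2 i iN ti [nag _]|st2 ex2 h2] :=
  @sumN_exec R 8%N enn
    (NMul eedge (NSub (NConst 1) (NSub (NConst 2) (NGet 6 (nvar 2)))))
    (n * n)%N st1 (f (fun m => 1 - (2 - m))%N).
- by rewrite /= !nag // n1 // hn.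
- by rewrite /= ti !nag // !n1 // hn.
have [n2 _] := exec_frame ex2.
exists st2; first exact: ESeq ex1 ex2.
rewrite n2 // h1 h2; split.
  by apply: (fE _ (fun m => m == 0%N)); case=> // m; rewrite subSS sub0n.
by apply: (fE _ (fun m => 1 < m)%N) => -[|[|m]].
Qed.

Lemma violation_prog_exec st (L : 'I_n -> 'I_n -> R) : input_ok st ->
    (forall u v : 'I_n,
       1 - rmem st 4 (midx n k (u * n + v) (n + k) k k) = L u v) ->
  exists2 st', exec violation_prog st st' &
    (nmem st' 9 0 == 0%N)
      = [forall u, forall v, L u v * n%:R <= gamma * k%:R].
Proof.
move=> [hn hk _ hg _] hL.
pose ok t := (1 - rmem st 4 (midx n k t (n + k) k k)) * n%:R <= gamma * k%:R.
pose I i st' := agree [pred b | (b != 2) && (b != 9)] predT st st' /\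
  (nmem st' 9 0 == 0%N) = [forall t : 'I_i, ok t].
pose st0 := State (upd (nmem st) 9 0 0%N) (rmem st).
have [||i st1 iN ti [[nag rag] ih]|st' ex' [_ h]] :=
  @for_exec R enn (If bviol (NSet 9 (NConst 0) (NConst 1)) Skip) (n * n)%N I st0.
- by move=> i st' [[nag _] _]; rewrite /= !nag // hn.
- split; last by rewrite /= /upd !eqxx; apply/esym/forallP => -[].
  by split=> // b /andP[b2 b9] j; rewrite /= /upd (negPf b2) (negPf b9).
- have bE : beval st1 bviol = ~~ ok i.
    by rewrite /= ti !nag // !rag // hn hk hg /ok ltNge.
  have okS : [forall t : 'I_i.+1, ok t] = [forall t : 'I_i, ok t] && ok i.
    apply/forallP/andP => [a|[/forallP a oi] t].
      split; last exact: (a ord_max).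
      by apply/forallP => t; exact: (a (widen_ord (leqnSn i) t)).
    have := ltn_ord t; rewrite ltnS leq_eqVlt => /predU1P[->//|ti'].
    exact: (a (Ordinal ti')).
  case oki: (ok i) bE => bE; last first.
    eexists; first by apply: EIfT bE _; exact: ENSet.
    split=> //; split; last by rewrite okS oki andbF.
    split=> // b /andP[b2 b9] j; rewrite /= /upd (negPf b2) (negPf b9) /=.
    by apply: nag; rewrite /= b2 b9.
  exists st1; first by apply: EIfF bE _; exact: ESkip.
  split=> //; split; last by rewrite okS oki andbT /= /upd.
  split=> // b /andP[b2 b9] j; rewrite /= /upd (negPf b2).
  by apply: nag; rewrite /= b2 b9.
exists st'; first by apply: ESeq ex'; exact: ENSet.
rewrite h; apply/forallP/forallP => [a u|a t].
  apply/forallP => v; have uv : (u * n + v < n * n)%N by rewrite ltn_pair.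
  by have := a (Ordinal uv); rewrite /ok /= hL.
have n0 : (0 < n)%N by case: (posnP n) t => // ->; case.
have un : (t %/ n < n)%N by rewrite ltn_divLR.
have vn : (t %% n < n)%N by rewrite ltn_mod.
have := a (Ordinal un) => /forallP/(_ (Ordinal vn)).
by rewrite -hL /= -divn_eq.
Qed.

Lemma check_prog_exec st B c : input_ok st ->
    rmem st 6 0 = denom_rank (fun _ _ => 1%N) ->
    nmem st 3 0 = B -> nmem st 4 0 = c ->
  exists2 st', exec check_prog st st' &
    [/\ forall u v : 'I_n, rmem st' 2 (u * n + v)%N = (digit n B c u v)%:R^-1
      & nmem st' 10 0 = acceptable (fun u v => digit n B c u v)].
Proof.
move=> ok hr hB hc; have [hn _ _ _ _] := ok.
pose d (u v : 'I_n) := digit n B c u v; rewrite -/d.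
have [st1 ex1 h1] := digits_prog_exec hn hB hc.
have ok1 : input_ok st1 by apply: input_ok_frame ex1 ok.
have [u v|st2 ex2 [l2 r2]] := @lev_prog_denom st1 d ok1.
  exact: (h1 u v).2.
have ok2 : input_ok st2 by apply: input_ok_frame ex2 ok1.
have [n1 rf1] := exec_frame ex1; have [n2 rf2] := exec_frame ex2.
have [|st3 ex3 [z3 f3]] := @count_prog_exec st2 d ok2.
  by move=> u v; rewrite n2 // (h1 u v).1.
have ok3 : input_ok st3 by apply: input_ok_frame ex3 ok2.
have [n3 rf3] := exec_frame ex3.
have [|st4 ex4 v4] := violation_prog_exec ok3 (L := fun u v =>
  lev (wdeg (fun=> 1) (denom_row d u)) (denom_row d u v)).
  by move=> u v; rewrite rf3 // l2.
have ok4 : input_ok st4 by apply: input_ok_frame ex4 ok3.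
have [n4 rf4] := exec_frame ex4; have [hn4 hk4 _ hg4 _] := ok4.
have bE : beval st4 baccept = acceptable d.
  rewrite /= /acceptable -v4 hn4 hk4 hg4 -!leNgt.
  rewrite (n4 7%N) // (n4 8%N) // z3 f3 !rf4 // !rf3 // r2 rf2 // rf1 // hr.
  by rewrite ltnS leqn0.
pose st5 := State (upd (nmem st4) 10 0 (acceptable d : nat)) (rmem st4).
exists st5.
  do 4!(apply: ESeq; first by eassumption).
  rewrite /st5; case: (acceptable d) bE => bE.
    by apply: EIfT bE _; exact: ENSet.
  by apply: EIfF bE _; exact: ENSet.
split=> //= u v; by rewrite rf4 // rf3 // rf2 // (h1 u v).2.
Qed.

End Check.

(** * The search *)

(* Runs through all pairs along the antidiagonals. *)
Definition next_pair (p : nat * nat) : nat * nat :=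
  if (0 < p.2)%N then (p.1.+1, p.2.-1) else (0%N, p.1.+1).

Definition next_prog : cmd :=
  If (BLtN (NConst 0) (nvar 4))
     (Seq (NSet 3 (NConst 0) (NAdd (nvar 3) (NConst 1)))
          (NSet 4 (NConst 0) (NSub (nvar 4) (NConst 1))))
     (Seq (NSet 4 (NConst 0) (NAdd (nvar 3) (NConst 1)))
          (NSet 3 (NConst 0) (NConst 0))).

Definition search_prog : cmd :=
  While (BLtN (nvar 10) (NConst 1)) (Seq next_prog check_prog).

(** With all factors equal to 1, [lev_prog] yields the rank of the unscaled graph, which is saved
    before the search overwrites real array 5. *)
Definition rank_prog : cmd :=
  Seq (FillR 2 enn (RNat (NConst 1))) (Seq lev_prog (RSet 6 (NConst 0) (rvar 5))).

(** Induction on the antidiagonal [s], then along it: [(s, 0)] is followed by [(0, s + 1)], the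
    start of the next one. *)
Lemma next_pair_surj a b : exists i, iter i next_pair (0%N, 0%N) = (a, b).
Proof.
suff H s : forall a, (a <= s)%N ->
    exists i, iter i next_pair (0%N, 0%N) = (a, (s - a)%N).
  by have := H (a + b)%N a (leq_addr _ _); rewrite addKn.
elim: s => [|s IH] a'; first by rewrite leqn0 => /eqP ->; exists 0%N.
elim: a' => [_|a' IHa ale].
  by have [i hi] := IH s (leqnn s); exists i.+1; rewrite iterS hi subnn.
have [i hi] := IHa (ltnW ale); exists i.+1; rewrite iterS hi /next_pair /=.
by rewrite subn_gt0 ale subSS subSn.
Qed.

Lemma digits_exist N (f : nat -> nat) B : (forall j, (j < N)%N -> (f j < B)%N) ->
  exists c, forall j, (j < N)%N -> (c %/ B ^ j %% B = f j)%N.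
Proof.
elim: N f => [|N IH] f fB; first by exists 0%N.
have [c hc] := IH (fun j => f j.+1) (fun j jN => fB j.+1 jN).
have [e1 e2] := divn_mod_pair c (fB 0%N isT).
exists (c * B + f 0%N)%N => -[_|j jN]; first by rewrite expn0 divn1.
by rewrite expnS divnMA e1 hc.
Qed.

Section Search.
Variables (R : realType) (n k : nat) (G : mwgraph R n k) (gamma : R).
Implicit Types st : state R.

Let accepted (p : nat * nat) :=
  acceptable G gamma (fun u v : 'I_n => digit n p.1 p.2 u v).

Lemma next_prog_exec st :
  exists2 st', exec next_prog st st' &
    (nmem st' 3 0, nmem st' 4 0) = next_pair (nmem st 3 0, nmem st 4 0).
Proof.
rewrite /next_pair /=; case: ifP => c0.
  eexists; first by apply: EIfT; [exact: c0 | apply: ESeq; exact: ENSet].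
  by rewrite /= /upd /= addn1 subn1.
eexists; first by apply: EIfF; [exact: c0 | apply: ESeq; exact: ENSet].
by rewrite /= /upd /= addn1.
Qed.

Lemma search_prog_exec r st :
    input_ok G gamma st -> rmem st 6 0 = denom_rank G (fun _ _ => 1%N) ->
    nmem st 10 0 = 0%N ->
    accepted (iter r.+1 next_pair (nmem st 3 0, nmem st 4 0)) ->
  exists (st' : state R) B c,
    [/\ exec search_prog st st', accepted (B, c)
      & forall u v : 'I_n, rmem st' 2 (u * n + v)%N = (digit n B c u v)%:R^-1].
Proof.
elim: r st => [|r IH] st ok h6 h10 acc.
all: have [st1 ex1 p1] := next_prog_exec st.
all: have [n1 r1] := exec_frame ex1.
all: have ok1 : input_ok G gamma st1 by apply: input_ok_frame ex1 ok.
all: have [|st2 ex2 [s2 a2]] := check_prog_exec ok1 _ erefl erefl;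
  first by rewrite r1.
all: have [n2 r2] := exec_frame ex2.
all: have b1 : beval st (BLtN (nvar 10) (NConst 1)) by rewrite /= h10.
all: have ex12 := ESeq ex1 ex2.
  exists st2, (nmem st1 3 0), (nmem st1 4 0).
  have acc1 : accepted (nmem st1 3 0, nmem st1 4 0) by rewrite p1.
  split=> //; apply: EWhileT b1 ex12 _; apply: EWhileF.
  by rewrite /= a2 -/(accepted (nmem st1 3 0, nmem st1 4 0)) acc1.
case acc1 : (accepted (nmem st1 3 0, nmem st1 4 0)).
  exists st2, (nmem st1 3 0), (nmem st1 4 0).
  split=> //; apply: EWhileT b1 ex12 _; apply: EWhileF.
  by rewrite /= a2 -/(accepted (nmem st1 3 0, nmem st1 4 0)) acc1.
have [||||st3 [B [c [ex3 acc3 s3]]]] := IH st2.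
- by apply: input_ok_frame ex2 ok1.
- by rewrite r2 // r1.
- by rewrite a2 -/(accepted (nmem st1 3 0, nmem st1 4 0)) acc1.
- by rewrite !n2 // p1 -iterSr.
exists st3, B, c; split=> //; exact: EWhileT b1 ex12 ex3.
Qed.

Lemma rank_prog_exec :
  exists2 st', exec rank_prog (init_state gamma G) st' &
    rmem st' 6 0 = denom_rank G (fun _ _ => 1%N).
Proof.
have ok := init_input_ok G gamma; have [hn _ _ _ _] := ok.
have [st1 [nag _]|//|//|st1 ex1 h1] :=
  @fillR_exec R 2%N enn (RNat (NConst 1)) (n * n)%N (init_state gamma G)
    (fun _ _ => 1).
  by rewrite /= !nag.
have ok1 : input_ok G gamma st1 by apply: input_ok_frame ex1 ok.
have [u v|st2 ex2 [_ r2]] := @lev_prog_denom R n k G gamma st1 (fun _ _ => 1%N) ok1.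
  by rewrite h1 ?ltn_pair // invr1.
eexists; first by apply: ESeq ex1 (ESeq ex2 _); exact: ERSet.
by rewrite /= /upd /= r2.
Qed.

(** * From undirected edges to pairs of vertices *)

Definition sort_pair (u v : 'I_n) : 'I_n * 'I_n :=
  if (u <= v)%N then (u, v) else (v, u).

(** Indexing by pairs gives both endpoints of an edge the same weight, as [good_denominators]
    expects; the zero vector marks absence at a vertex. *)
Definition incidence (u : 'I_n) (p : 'I_n * 'I_n) : 'cV[R]_k :=
  if (p \in edges G) && ((u == p.1) || (u == p.2)) then phi G p.1 p.2 else 0.

Lemma sort_pair_edge u v : adj G u v ->
  (sort_pair u v \in edges G) /\ phi G (sort_pair u v).1 (sort_pair u v).2 = phi G u v.
Proof.
move=> uv; have neq : u != v.
  by apply: contraTneq uv => ->; rewrite adj_irr.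
rewrite /sort_pair inE; case: (leqP u v) => h /=; last by rewrite h adj_sym phi_sym.
by rewrite ltn_neqAle neq h.
Qed.

Lemma incidence_sort u v : adj G u v -> incidence u (sort_pair u v) = phi G u v.
Proof.
move=> uv; have [h1 h2] := sort_pair_edge uv; rewrite /incidence h1 h2 /=.
by rewrite /sort_pair; case: (leqP u v) => _ /=; rewrite eqxx ?orbT.
Qed.

(** Reindex by [sort_pair u]: the inverse sends an edge at [u] to its other endpoint. *)
Lemma wdeg_incidence (w : 'I_n * 'I_n -> R) u :
  wdeg w (incidence u) = wdeg (fun v => w (sort_pair u v)) (edge_vec G u).
Proof.
pose P p := (p \in edges G) && ((u == p.1) || (u == p.2)).
transitivity (\sum_(p | P p) w p *: (phi G p.1 p.2 *m (phi G p.1 p.2)^T)).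
  rewrite [RHS]big_mkcond; apply: eq_bigr => p _; rewrite /incidence -/(P p).
  by case: ifP => // _; rewrite mul0mx scaler0.
rewrite (reindex_onto (sort_pair u) (fun p => if u == p.1 then p.2 else p.1)).
  rewrite big_mkcond /=; apply: eq_bigr => v _.
  have -> : P (sort_pair u v) && ((if u == (sort_pair u v).1 then (sort_pair u v).2
      else (sort_pair u v).1) == v) = adj G u v.
    apply/andP/idP => [[]|uv].
      rewrite /P inE /sort_pair; case: (leqP u v) => _ /= /andP[/andP[_ h] _] _ //.
      by rewrite adj_sym.
    have [h1 _] := sort_pair_edge uv; rewrite /P h1 /sort_pair.
    case: (leqP u v) => [_|vu] /=; rewrite ?eqxx ?orbT //.
    by split=> //; case: (eqVneq u v) => [->|_]; rewrite eqxx.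
  rewrite /edge_vec; case: ifP => uv; last by rewrite mul0mx scaler0.
  by rewrite (sort_pair_edge uv).2.
move=> [a b]; rewrite /P inE /= => /andP[/andP[ab _]].
have [->|ua] /= := eqVneq u a; first by rewrite /sort_pair ltnW.
by move/eqP->; rewrite /sort_pair leqNgt ab.
Qed.

Lemma wdeg_denom (d : 'I_n -> 'I_n -> nat) (dE : 'I_n * 'I_n -> nat) u :
    (forall u v, d u v = dE (sort_pair u v)) ->
  wdeg (fun=> 1) (denom_row G d u) = wdeg (fun p => (dE p)%:R^-1 ^+ 2) (incidence u).
Proof.
move=> dd; rewrite wdeg_incidence; apply: eq_bigr => v _.
by rewrite /denom_row dd scale1r linearZ /= -scalemxAl -scalemxAr scalerA expr2.
Qed.

(** Apply [good_denominators] with [tau = gamma k / n]; then [8 n k / tau = 8 n^2 / gamma]. The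
    denominators of its solution are the base [B] digits of a code. *)
Lemma acceptable_exists : (0 < n)%N -> (0 < k)%N -> 1 <= gamma ->
  exists B c, (0 < B)%N /\ accepted (B, c).
Proof.
move=> n0 k0 g1; pose tau : R := gamma * k%:R / n%:R.
have nR : 0 < n%:R :> R by rewrite ltr0n.
have kR : 0 < k%:R :> R by rewrite ltr0n.
have g0 : 0 < gamma by lra.
have tau0 : 0 < tau by rewrite divr_gt0 // mulr_gt0.
have tauE : tau * n%:R = gamma * k%:R by rewrite /tau divfK // gt_eqF.
have [dE [dlev dfrac dzero]] := good_denominators incidence tau0.
pose f t := ext_ord 0%N (fun u : 'I_n =>
  ext_ord 0%N (fun v : 'I_n => dE (u, v)) (t %% n)%N) (t %/ n)%N.
have fE (u v : 'I_n) : f (u * n + v)%N = dE (u, v).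
  have [e1 e2] := divn_mod_pair u (ltn_ord v).
  by rewrite /f e1 e2 /ext_ord !valK.
pose B := (\sum_(t < n * n) f t).+1.
have fB t : (t < n * n)%N -> (f t < B)%N.
  by move=> tn; rewrite ltnS (bigD1 (Ordinal tn)) //= leq_addr.
have [c hc] := digits_exist fB; exists B, c; split=> //.
pose d (u v : 'I_n) := digit n B c u v.
have dd u v : d u v = dE (sort_pair u v).
  have dle (a b : 'I_n) : (a <= b)%N -> d a b = dE (a, b).
    move=> ab; rewrite /d /digit (minn_idPl ab) (maxn_idPr ab) hc ?ltn_pair //.
  rewrite /sort_pair; case: (leqP u v) => [|/ltnW] h; first exact: dle.
  by rewrite /d digit_sym -/(d v u) dle.
have wE u := wdeg_denom u dd.
have w1 u : wdeg (fun=> 1) (denom_row G (fun _ _ => 1%N) u)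
    = wdeg (fun=> 1) (incidence u).
  rewrite (@wdeg_denom _ (fun=> 1%N)) //; apply: eq_bigr => p _.
  by rewrite invr1 expr1n.
have dp p : p \in edges G -> d p.1 p.2 = dE p.
  by case: p => a b; rewrite inE dd => /andP[/ltnW ab _]; rewrite /sort_pair ab.
(* Only an inequality holds, since the counts on the right include pairs that are not edges. *)
have cardle (P : pred nat) : (#|[set p in edges G | P (d p.1 p.2)]|
    <= #|[set p | P (dE p)]|)%N.
  apply: subset_leq_card; apply/subsetP => p; rewrite !inE => /andP[pE].
  by rewrite dp // inE.
rewrite /accepted /acceptable -/d; apply/and3P; split.
- apply/forallP => u; apply/forallP => v; rewrite -tauE ler_pM2r //.
  rewrite wE /denom_row levZ dd /edge_vec; case: ifP => [uv|_].
    by rewrite -(incidence_sort uv); exact: dlev.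
  by rewrite levE /dotc trmx0 mul0mx mxE mulr0 ltW.
- have := cardle (fun m => m == 0%N); rewrite -(ler_nat R) => le1.
  rewrite -tauE /denom_rank; under eq_bigr do rewrite w1.
  under [X in _ - X]eq_bigr do rewrite wE.
  have := le_trans (ler_wpM2r (ltW tau0) le1) dzero; set D := _ - _ => le2.
  have -> : 8 * n%:R * D = 8 * D * n%:R by ring.
  by rewrite mulrA ler_wpM2r // ltW.
have := cardle (fun m => 1 < m)%N; rewrite -(ler_nat R) => le1.
have := le_trans (ler_wpM2r (ltW tau0) le1) dfrac; rewrite card_ord => le2.
rewrite -(ler_pM2r kR) -mulrA -tauE mulrA.
have -> : (8 * (n * n))%:R * k%:R = 8 * (n * k)%:R * n%:R :> R.
  by rewrite !natrM; ring.
by rewrite ler_wpM2r // ltW.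
Qed.

Lemma inv_nat_in01 (m : nat) : 0 <= (m%:R^-1 : R) <= 1.
Proof.
rewrite invr_ge0 ler0n /=; case: m => [|m]; first by rewrite invr0 ler01.
by rewrite invf_le1 ?ltr0n // ler1n.
Qed.

Definition denom_scaling (d : 'I_n -> 'I_n -> nat)
    (dsym : forall u v, d u v = d v u) : scaling G :=
  @Scaling R n k G (fun u v => (d u v)%:R^-1)
    (fun u v => congr1 (fun m : nat => (m%:R)^-1) (dsym u v))
    (fun u v _ => inv_nat_in01 (d u v)).

Lemma acceptable_scaling (d : 'I_n -> 'I_n -> nat)
    (dsym : forall u v, d u v = d v u) (s := denom_scaling dsym) :
    (0 < n)%N -> (0 < k)%N -> 1 <= gamma -> acceptable G gamma d ->
  [/\ almost_regular gamma (rescale s),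
      #|[set p in edges G | 0 < scal s p.1 p.2 < 1]|%:R
        <= 8 * n%:R ^+ 2 / gamma
    & #|[set p in edges G | scal s p.1 p.2 == 0]|%:R
        <= 8 * n%:R / (gamma * k%:R)
           * ((\rank (degmx G))%:R - (\rank (degmx (rescale s)))%:R)].
Proof.
move=> n0 k0 g1 /and3P[/forallP hlev hzero hfrac].
have nR : 0 < n%:R :> R by rewrite ltr0n.
have kR : 0 < k%:R :> R by rewrite ltr0n.
have g0 : 0 < gamma by lra.
have vdegE u : vdeg (rescale s) u = wdeg (fun=> 1) (denom_row G d u).
  rewrite /vdeg big_mkcond; apply: eq_bigr => v _ /=.
  rewrite /denom_row /edge_vec scale1r; case: ifP => // _.
  by rewrite scaler0 mul0mx.
have vdeg1 u : vdeg G u = wdeg (fun=> 1) (denom_row G (fun _ _ => 1%N) u).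
  rewrite /vdeg big_mkcond; apply: eq_bigr => v _ /=.
  rewrite /denom_row /edge_vec scale1r invr1 scale1r; case: ifP => // _.
  by rewrite mul0mx.
split.
- move=> u v uv; rewrite vdegE ler_pdivlMr //.
  have /forallP/(_ v) := hlev u; rewrite {2}/denom_row /edge_vec.
  by move: uv; rewrite /= => ->.
- rewrite ler_pdivlMr // expr2 -natrM -natrM; apply: le_trans hfrac.
  rewrite ler_pM2r // ler_nat subset_leq_card //; apply/subsetP => p.
  (* Denominators 0 and 1 give the scalings 0 and 1, which are not fractional. *)
  rewrite !inE => /andP[-> /=]; case: (d p.1 p.2) => [|[|m]] //.
    by rewrite invr0 ltxx.
  by rewrite invr1 ltxx andbF.
rewrite /degmx !rank_mxdiag !natr_sum.
under eq_bigr do rewrite vdeg1.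
under [X in _ - X]eq_bigr do rewrite vdegE.
rewrite mulrAC ler_pdivlMr ?mulr_gt0 //; apply: le_trans hzero.
rewrite ler_pM2r ?mulr_gt0 // ler_nat subset_leq_card //; apply/subsetP => p.
by rewrite !inE => /andP[-> /=]; rewrite invr_eq0 pnatr_eq0.
Qed.

End Search.

Theorem theorem9p1 (R : realType) :
  exists prog : cmd,
    forall (n k : nat) (G : mwgraph R n k) (gamma : R),
      (0 < n)%N -> (0 < k)%N -> 1 <= gamma ->
      exists (st : state R) (s : scaling G),
        [/\ exec prog (init_state gamma G) st,
            outputs st s,
            almost_regular gamma (rescale s),
            #|[set p in edges G | 0 < scal s p.1 p.2 < 1]|%:R
              <= 8 * n%:R ^+ 2 / gamma
          & #|[set p in edges G | scal s p.1 p.2 == 0]|%:R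
              <= 8 * n%:R / (gamma * k%:R)
                 * ((\rank (degmx G))%:R - (\rank (degmx (rescale s)))%:R)].
Proof.
exists (Seq rank_prog search_prog) => n k G gamma n0 k0 g1.
have [B [c [B0 acc]]] := acceptable_exists G n0 k0 g1.
have [r hr] := next_pair_surj B c.
have [st1 ex1 h1] := rank_prog_exec G gamma.
have [nf _] := exec_frame ex1.
have ok1 := input_ok_frame (isT : ~~ [|| nwrites rank_prog 0, nwrites rank_prog 1,
  rwrites rank_prog 0 | rwrites rank_prog 1]) ex1 (init_input_ok G gamma).
have [st [B' [c' [ex acc' out]]]] : exists (st' : state R) B' c',
    [/\ exec search_prog st1 st',
        acceptable G gamma (fun u v : 'I_n => digit n B' c' u v)
      & forall u v : 'I_n, rmem st' 2 (u * n + v)%N = (digit n B' c' u v)%:R^-1].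
  (* The search advances before its first test, so [(0, 0)] is never tested there; [0 < B] rules it
     out as the target. *)
  case: r hr => [[hB _]|r hr]; first by rewrite -hB in B0.
  apply: (@search_prog_exec R n k G gamma r st1) => //; first by rewrite nf.
  by rewrite !nf // hr.
pose s := denom_scaling G (fun u v : 'I_n => digit_sym n B' c' u v).
have [reg frac zero] := @acceptable_scaling R n k G gamma _
  (fun u v : 'I_n => digit_sym n B' c' u v) n0 k0 g1 acc'.
by exists st, s; split=> //; exact: ESeq ex1 ex.
Qed.
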